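(* Let $\pi\in\mathcal{S}_n$, and let $\overline{N}(\pi)=\min\{k\ge2:\pi\in\operatorname{Allow}(\Sigma_{-k})\}$. Then $$\overline{N}(\pi)=1+\operatorname{asc}(\hat\pi^\star)+\overline{\epsilon}(\hat\pi^\star),$$ where $\overline{\epsilon}(\hat\pi^\star)=1$ if $\pi$ is cornered or collapsed, and $\overline{\epsilon}(\hat\pi^\star)=0$ if $\pi$ is regular. Additionally, the number of valid $-\overline{N}(\pi)$-segmentations of $\hat\pi^\star$ is $1$ if $\pi$ is regular, $2$ if $\pi$ is cornered, and $\min\{n-x,n-y\}$ if $\pi$ is collapsed, where (for collapsed $\pi$) $x$ and $y$ are the indices with $\pi_x=\pi_n+1$ and $\pi_y=\pi_n-1$.
   Context: **Negative shift.** Let $\mathcal{W}_k$ be the set of infinite words $w=w_1w_2\cdots$ on $\{0,\dots,k-1\}$, ordered by: for $v\ne w$ with first difference at position $j$, $v<w$ iff $(-1)^{j-1}(w_j-v_j)>0$. The $-k$-shift $\Sigma_{-k}:\mathcal{W}_k\to\mathcal{W}_k$ is $w_1w_2w_3\cdots\mapsto w_2w_3\cdots$ (the signed shift with signature $-^k$). A permutation $\pi\in\mathcal{S}_n$ is in $\operatorname{Allow}(\Sigma_{-k})$ iff there is $w\in\mathcal{W}_k$ such that the words $w_iw_{i+1}\cdots$ ($1\le i\le n$) are distinct and in the same relative order (with respect to this order) as $\pi_1,\dots,\pi_n$. **Marked cycle.** $\hat\pi^\star=\hat\pi^\star_1\cdots\hat\pi^\star_n$ is defined by $\hat\pi^\star_{\pi_i}=\pi_{i+1}$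 for $1\le i\le n-1$ and $\hat\pi^\star_{\pi_n}=\star$ (a symbol). For $1\le j\le n-1$, $j$ is an ascent of $\hat\pi^\star$ if $\hat\pi^\star_j<\hat\pi^\star_{j+1}$ (both numbers), or $\hat\pi^\star_{j+1}=\star$ and $\hat\pi^\star_j<\hat\pi^\star_{j+2}$ (with $j+2\le n$). $\operatorname{asc}(\hat\pi^\star)$ is the number of ascents. A block is decreasing if it is so after deleting $\star$, if present. **$-k$-segmentation** ($k\ge1$). A sequence $E=(e_0,\dots,e_k)$ of integers with $0=e_0\le e_1\le\dots\le e_k=n$ such that: $\hat\pi^\star_{e_t+1}\cdots\hat\pi^\star_{e_{t+1}}$ is decreasing for all $0\le t\le k-1$; if $\pi_{n-2}\pi_{n-1}\pi_n=(n-1)\,1\,n$, then $e_1=0$ or $e_{k-1}=n-1$; if $\pi_{n-2}\pi_{n-1}\pi_n=2\,n\,1$, then $e_1=0$ or $e_{k-1}=n$; and $e_t\ne\pi_n$ for $1\le t\le k-1$. Its associated prefix is $\zeta=z_1\cdots z_{n-1}$ with $z_i=j$ whenever $e_j<\pi_i\le e_{j+1}$. **Validity.** If $\pi_n\ne n$, let $x$ be such that $\pi_x=\pi_n+1$ and $p=z_xz_{x+1}\cdots z_{n-1}$; if $\pi_n\ne1$, let $y$ be such that $\pi_y=\pi_n-1$ and $q=z_y\cdots z_{n-1}$. A segmentation is invalid if $\pi_n\notin\{1,n\}$ and ($p=q^2$ or $q=p^2$); otherwise valid. **Types of permutations.** The minimal negative segmentation of $\hat\pi^\star$ is the (unique,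 when it exists) $-k$-segmentation with $k=1+\operatorname{asc}(\hat\pi^\star)$, whose indices besides $0$ and $n$ are the ascents of $\hat\pi^\star$; it exists unless $\pi_{n-2}\pi_{n-1}\pi_n\in\{(n-1)\,1\,n,\ 2\,n\,1\}$. $\pi$ is cornered if $\pi_{n-2}\pi_{n-1}\pi_n=(n-1)\,1\,n$ or $\pi_{n-2}\pi_{n-1}\pi_n=2\,n\,1$; collapsed if the minimal negative segmentation exists but is invalid; regular if it is neither cornered nor collapsed.
   Formalization: The formal theorem assumes n ≥ 3; for n = 1 and n = 2 every permutation is regular with no ascents of the marked cycle, so the stated formula gives 1, although N̄(π) is a minimum over k ≥ 2. *)

(* Defs.v *)
From mathcomp Require Import all_boot all_order all_algebra all_fingroup.

Set Implicit Arguments.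
Unset Strict Implicit.
Unset Printing Implicit Defensive.

(* A permutation enters all the definitions through its one-line notation     *)
(* pi_1 ... pi_n, a sequence whose entries are numbered from 1 and take their *)
(* values in {1, ..., n}.                                                     *)
Definition one_line (n : nat) (s : 'S_n) : seq nat :=
  [seq (s i).+1 | i : 'I_n].

Section OneLine.
Variable pi : seq nat.

Let n : nat := size pi.

(* The dummy entry 0 shifts the 0-based nth and index to 1-based ones. *)
Definition entry (i : nat) : nat := nth 0 (0 :: pi) i.
Definition position (v : nat) : nat := index v (0 :: pi).

(* The marked cycle, None being the star; meaningful for 1 <= v <= n, and     *)
(* None for v > n.                                                            *)
Definition hat_star (v : nat) : option nat :=
  let i := position v in if i < n then Some (entry i.+1) else None.

Definition ascent (j : nat) : bool :=
  match hat_star j, hat_star j.+1 with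
  | Some a, Some b => a < b
  | Some a, None =>
      (j.+2 <= n) && (if hat_star j.+2 is Some b then a < b else false)
  | None, _ => false
  end.

Definition ascents : seq nat := [seq j <- iota 1 n.-1 | ascent j].

Definition asc : nat := size ascents.

(* pmap drops the star from the block a+1, ..., b of the marked cycle. *)
Definition decreasing_block (a b : nat) : bool :=
  sorted gtn (pmap hat_star (iota a.+1 (b - a))).

Definition ends_with (a b c : nat) : bool :=
  [&& 3 <= n, entry (n - 2) == a, entry (n - 1) == b & entry n == c].

Definition cornered : bool := ends_with n.-1 1 n || ends_with 2 n 1.

Definition neg_segmentation (k : nat) (E : seq nat) : bool :=
  let e := nth 0 E in
  [&& size E == k.+1,
      [&& e 0 == 0, sorted leq E & e k == n],
      all (fun t => decreasing_block (e t) (e t.+1)) (iota 0 k),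
      ends_with n.-1 1 n ==> (e 1 == 0) || (e k.-1 == n.-1),
      ends_with 2 n 1 ==> (e 1 == 0) || (e k.-1 == n)
    & all (fun t => e t != entry n) (iota 1 k.-1)].

(* The j such that e_j < pi_i <= e_(j+1). *)
Definition prefix_letter (E : seq nat) (i : nat) : nat :=
  find (fun j => nth 0 E j < entry i <= nth 0 E j.+1) (iota 0 (size E).-1).

(* The word z_i z_(i+1) ... z_(n-1). *)
Definition prefix_tail (E : seq nat) (i : nat) : seq nat :=
  [seq prefix_letter E l | l <- iota i (n - i)].

Definition xpos : nat := position (entry n).+1.
Definition ypos : nat := position (entry n).-1.

Definition invalid (E : seq nat) : bool :=
  let p := prefix_tail E xpos in
  let q := prefix_tail E ypos in
  [&& entry n != 1, entry n != n & (p == q ++ q) || (q == p ++ p)].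

Definition valid_neg_segmentation (k : nat) (E : seq nat) : bool :=
  neg_segmentation k E && ~~ invalid E.

(* The only sequence that can be the minimal negative segmentation; the       *)
(* latter exists when this sequence is a segmentation.                        *)
Definition minimal_sequence : seq nat := 0 :: rcons ascents n.

Definition minimal_neg_segmentation (E : seq nat) : bool :=
  (E == minimal_sequence) && neg_segmentation (1 + asc) E.

Definition collapsed : bool :=
  minimal_neg_segmentation minimal_sequence && invalid minimal_sequence.

Definition regular : bool := ~~ cornered && ~~ collapsed.

Definition epsilon_bar : nat := if cornered || collapsed then 1 else 0.

(* The entries of a segmentation lie in {0, ..., n}, so the segmentations are *)
(* found among the tuples over 'I_(n.+1).                                     *)
Definition num_valid_neg_segmentations (k : nat) : nat :=
  #|[set E : (k.+1).-tuple 'I_n.+1 |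
      valid_neg_segmentation k [seq val e | e <- E]]|.

End OneLine.

(* The letter w_j of the word w_1 w_2 ... is w (j - 1). *)
Definition word (k : nat) : Type := nat -> 'I_k.

Definition word_lt (k : nat) (v w : word k) : Prop :=
  exists j : nat,
    (forall i, i < j -> v i = w i) /\
    (0 < (-1) ^+ j * ((w j)%:Z - (v j)%:Z) :> int)%R.

Definition neg_shift (k : nat) (w : word k) : word k := fun i => w i.+1.

(* The i-th word of the orbit, counted from 0, is compared with pi_(i+1). *)
Definition allow_neg_shift (n k : nat) (s : 'S_n) : Prop :=
  exists w : word k,
    let u (i : 'I_n) : word k := iter i (@neg_shift k) w in
    (forall i j : 'I_n, i != j -> ~ (u i =1 u j)) /\
    (forall i j : 'I_n, word_lt (u i) (u j) <-> s i < s j).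

(* N = min {k >= 2 : s is allowed by the -k-shift}. *)
Definition is_Nbar (n : nat) (s : 'S_n) (N : nat) : Prop :=
  [/\ 2 <= N, allow_neg_shift N s &
      forall k : nat, 2 <= k -> allow_neg_shift k s -> N <= k].

(* Main.v *)
Require Import Defs.
From mathcomp Require Import all_boot all_order all_algebra all_fingroup.
From mathcomp Require Import zify.

(** Write u_i for the word w_i w_(i+1) ... of an orbit, and x, y for the
    positions of the values pi_n + 1 and pi_n - 1. Two words with the same first
    letter compare in the alternating order as their tails do, reversed. Hence,
    if the words u_i are ordered as pi, then the letters before position n are
    weakly increasing in pi, and two positions before n with the same letter
    have their successors in the opposite order: the values carrying a given
    letter form a block on which the marked cycle decreases. So w defines a
    segmentation, with the cuts between its blocks, and every ascent of the
    marked cycle has to be a cut.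

    Conversely, given the letters z of a segmentation, a comparison of two words
    u_i reduces letter by letter to a comparison with the tail u_n. It is enough
    that u_y < u_n < u_x, where u_y = q u_n and u_x = p u_n are the words of the
    neighbouring values (order_of_neighbours). If pi_n = n, the tail is the
    largest word K 0 K 0 ..., where K = k - 1, and the condition on cornered
    permutations is what makes u_y different from it (top_tail); pi_n = 1 is the
    complement of this case. Otherwise let p be the shorter of p and q, again up to complement. The
    tail is an even power of p followed by the smallest word, a word just below
    p p p ..., so that u_n < p u_n. Moreover q u_n < u_n, because
    q p p p ... < p p p ... (periodic_tail_lt): the comparison has
    the right sign at the first difference, and if there were no difference, then
    p and q would be powers of one word, with an exponent at most 2 for the
    longer one (short_period). That is the case q = p p of an invalid
    segmentation. For an invalid segmentation, no tail exists: with q = p p, the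
    words p u_n and p p u_n lie on the same side of u_n (square_same_side).
    Altogether, pi is allowed by the -k-shift exactly when a valid
    -k-segmentation exists (valid_segmentation_allowed and
    allowed_valid_segmentation).

    It remains to find the smallest valid segmentations. The blocks between
    given cuts are decreasing exactly when all ascents are cuts
    (decreasing_blocks_ascents), so that at least 1 + asc blocks are needed, and
    only the minimal sequence has that many. It is a valid segmentation for a
    regular permutation and for no other. Otherwise one extra cut m is added. A
    cornered permutation admits two values of m. For a collapsed permutation let
    a and b be the smaller and the larger of x and y, so that z_a ... z_(n-1) is
    the square of z_b ... z_(n-1). The extra cut m destroys this square when it
    separates the values at a + i and b + i for some i < n - b. These values are
    adjacent for 0 < i (adjacent_pairs), and the pair with i = 0 surrounds pi_n,
    which is not allowed as a cut; so each of the n - b = min (n - x, n - y)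
    pairs contributes one cut. *)

Set Implicit Arguments.
Unset Strict Implicit.
Unset Printing Implicit Defensive.

(** * The alternating order on words *)

(** The position d of the first difference is kept explicit: the proofs below
    are inductions on it, or comparisons of several such positions. *)
Definition lt_at (d : nat) (v w : nat -> nat) : Prop :=
  (forall i, i < d -> v i = w i) /\ (if odd d then w d < v d else v d < w d).

Definition alt_lt (v w : nat -> nat) : Prop := exists d, lt_at d v w.

(** Positions are numbered from 1, as in one-line notation. *)
Definition tail_from (W : nat -> nat) (i : nat) : nat -> nat := fun m => W (i + m).

Lemma lt_at_eq d v w v' w' :
  (forall i, i <= d -> v i = v' i) -> (forall i, i <= d -> w i = w' i) ->
  lt_at d v w -> lt_at d v' w'.
Proof.
move=> ev ew [agree lt_d]; split=> [i lt_id|]; last by rewrite -ev // -ew.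
by rewrite -ev ?(ltnW lt_id) // -ew ?(ltnW lt_id) // agree.
Qed.

Lemma lt_at_trans d e u v w :
  lt_at d u v -> lt_at e v w -> lt_at (minn d e) u w.
Proof.
move=> [uv ltd] [vw lte]; split=> [i|].
  by rewrite leq_min => /andP[id ie]; rewrite uv // vw.
case: (ltngtP d e) => [lt_de|lt_ed|eq_de].
- by rewrite -(vw d lt_de).
- by rewrite (uv e lt_ed).
- by move: ltd lte; rewrite -eq_de; case: (odd d); lia.
Qed.

Lemma lt_at_irr d v : ~ lt_at d v v.
Proof. by case=> _; rewrite ltnn if_same. Qed.

Lemma alt_lt_trans u v w : alt_lt u v -> alt_lt v w -> alt_lt u w.
Proof. by move=> [d uv] [e vw]; exists (minn d e); apply: lt_at_trans uv vw. Qed.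

Lemma alt_lt_asym v w : alt_lt v w -> ~ alt_lt w v.
Proof. by move=> vw wv; have [d /lt_at_irr] := alt_lt_trans vw wv. Qed.

Lemma alt_lt_head v w : alt_lt v w -> v 0 <= w 0.
Proof. by case=> [[|d] [agree]] => [/ltnW|_] //; rewrite agree. Qed.

Lemma lt_at_shift d e v w : (forall i, i < d -> v i = w i) ->
  lt_at e (tail_from v d) (tail_from w d) ->
  if odd d then lt_at (d + e) w v else lt_at (d + e) v w.
Proof.
move=> agree [agree' lt_e].
have agr i : i < d + e -> v i = w i.
  move=> lt_i; case: (ltnP i d) => [/agree //|le_di].
  by rewrite -(subnKC le_di); apply: agree'; lia.
rewrite /lt_at oddD; rewrite /tail_from in lt_e.
by case: (odd d) lt_e; case: (odd e) => //= lt_e; split=> // i /agr.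
Qed.

Lemma alt_lt_tail v w : v 0 = w 0 ->
  alt_lt v w -> alt_lt (tail_from w 1) (tail_from v 1).
Proof.
move=> eq0 [[|d] [agree lt_d]]; first by rewrite /= eq0 ltnn in lt_d.
exists d; split=> [i lt_id|]; first by rewrite /tail_from agree.
by move: lt_d => /=; rewrite /tail_from !add1n; case: (odd d).
Qed.

Lemma first_difference v w d :
  (forall i, i < d -> v i = w i) \/
  exists2 e, e < d & lt_at e v w \/ lt_at e w v.
Proof.
elim: d => [|d [agree|[e lt_ed]]]; [by left | | by right; exists e => //; lia].
case: (ltngtP (v d) (w d)) => [lt_d|lt_d|eq_d].
- right; exists d => //; rewrite /lt_at.
  by case: (odd d); [right|left]; split=> // i /agree.
- right; exists d => //; rewrite /lt_at.
  by case: (odd d); [left|right]; split=> // i /agree.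
- by left=> i; rewrite ltnS leq_eqVlt => /predU1P[->|/agree].
Qed.

Lemma lt_at_complement K d v w : (forall i, v i <= K) -> (forall i, w i <= K) ->
  lt_at d v w -> lt_at d (fun i => K - w i) (fun i => K - v i).
Proof.
move=> v_le w_le [agree lt_d]; split=> [i /agree -> //|].
by move: (v_le d) (w_le d) lt_d; case: (odd d); lia.
Qed.

Definition max_word (K : nat) (i : nat) : nat := if odd i then 0 else K.
Definition min_word (K : nat) (i : nat) : nat := K - max_word K i.

Lemma max_word_le K i : max_word K i <= K.
Proof. by rewrite /max_word; case: odd. Qed.

Lemma max_word_maximal K d v w : (forall i, w i <= K) ->
  v d = max_word K d -> ~ lt_at d v w.
Proof.
by move=> w_le v_d [_]; rewrite v_d /max_word; move: (w_le d); case: odd; lia.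
Qed.

(** What a segmentation retains of an orbit: P is the one-line notation as a
    function on the positions 1, ..., n, and z gives the letters before
    position n. These are at most K. *)
Record labelling (n : nat) (P z : nat -> nat) (K : nat) : Prop := Labelling {
  entry_range : forall i, 0 < i <= n -> 0 < P i <= n;
  entry_inj : forall i j, 0 < i <= n -> 0 < j <= n -> P i = P j -> i = j;
  entry_onto : forall v, 0 < v <= n -> exists2 i, 0 < i <= n & P i = v;
  letter_le : forall i, 0 < i < n -> z i <= K;
  letter_mono : forall i j, 0 < i < n -> 0 < j < n -> P i < P j -> z i <= z j;
  letter_anti : forall i j, 0 < i < n -> 0 < j < n ->
    P i < P j -> z i = z j -> P j.+1 < P i.+1
}.

(** Replacing each letter a by K - a reverses the alternating order. This
    symmetry exchanges the two values next to P n, and the cases P n = 1 and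
    P n = n. *)
Lemma labelling_complement n P z K : labelling n P z K ->
  labelling n (fun i => n.+1 - P i) (fun i => K - z i) K.
Proof.
case=> rg inj onto le mono anti.
split.
- by move=> i /rg; lia.
- by move=> i j i_in j_in eqP; apply: inj => //; move: (rg i i_in) (rg j j_in); lia.
- move=> v v_in; have /onto[i i_in eqP] : 0 < n.+1 - v <= n by lia.
  by exists i => //; lia.
- by move=> i _; apply: leq_subr.
- move=> i j i_in j_in ltP; apply: leq_sub2l; apply: mono => //; lia.
- move=> i j i_in j_in ltP eqz.
  have : P i.+1 < P j.+1.
    apply: anti => //; [lia | by move: (le i i_in) (le j j_in); lia].
  by have := rg j.+1; have := rg i.+1; lia.
Qed.

Section Ordering.

Variables (n K : nat) (P z W : nat -> nat).
Hypothesis lab : labelling n P z K.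
Hypothesis W_prefix : forall l, 0 < l < n -> W l = z l.
Hypothesis above : forall x, 0 < x < n -> P x = (P n).+1 ->
  alt_lt (tail_from W n) (tail_from W x).
Hypothesis below : forall y, 0 < y < n -> (P y).+1 = P n ->
  alt_lt (tail_from W y) (tail_from W n).

(** Induction on the position d of the difference. If both positions are before
    n, the common first letter is removed. A comparison with u_n is passed on to
    a neighbour: from u_j < u_n < u_x, the words u_j and u_x, both starting before
    n, have a wrong difference at d or earlier. *)
Lemma no_wrong_difference d i j : 0 < i <= n -> 0 < j <= n -> P i < P j ->
  ~ lt_at d (tail_from W j) (tail_from W i).
Proof.
elim/ltn_ind: d i j => d IH.
have inner e i j : e <= d -> 0 < i < n -> 0 < j < n -> P i < P j ->
    ~ lt_at e (tail_from W j) (tail_from W i).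
  move=> le_ed i_in j_in ltP [agree].
  case: e le_ed agree => [|e] le_ed agree.
    rewrite /= /tail_from !addn0 !W_prefix //.
    by have := letter_mono lab i_in j_in ltP; lia.
  move=> lt_e.
  have eq_z : z i = z j.
    by have := agree 0 isT; rewrite /tail_from !addn0 !W_prefix.
  apply: (IH e le_ed j.+1 i.+1); [lia | lia | exact: letter_anti lab _ _ _ _ _ _|].
  split=> [m lt_me|]; first by have := agree m.+1 lt_me; rewrite /tail_from !addSnnS.
  by move: lt_e => /=; rewrite /tail_from !addSnnS; case: (odd e).
move=> i j i_in j_in ltP lt_d.
have [lt_in|] := boolP (i < n); last first.
  move=> ge_in; have ei : i = n by lia.
  subst i; have j_lt : 0 < j < n.
    by have : j <> n by [move=> e; rewrite e ltnn in ltP]; lia.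
  have [x x_in Px] : exists2 x, 0 < x <= n & P x = (P n).+1.
    by apply: (entry_onto lab); have := entry_range lab j_in; lia.
  have x_lt : 0 < x < n.
    by have : x <> n by [move=> e; rewrite e in Px; lia]; lia.
  have [ejx|njx] := eqVneq j x.
    by subst j; apply: (alt_lt_asym (above x_lt Px)); exists d.
  have [e lt_e] := above x_lt Px.
  apply: (inner (minn d e) x j) (lt_at_trans lt_d lt_e) => //; first exact: geq_minl.
  have : P j <> P x by move/(entry_inj lab j_in x_in) => e'; rewrite e' eqxx in njx.
  lia.
have [lt_jn|ge_jn] := boolP (j < n); first by apply: (inner d i j) lt_d => //; lia.
have ej : j = n by lia.
subst j.
have [y y_in Py] : exists2 y, 0 < y <= n & P y = (P n).-1.
  by apply: (entry_onto lab); have := entry_range lab i_in; have := entry_range lab j_in; lia.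
have y_lt : 0 < y < n.
  by have : y <> n by [move=> e; rewrite e in Py; lia]; lia.
have Py' : (P y).+1 = P n by lia.
have [eiy|niy] := eqVneq i y.
  by subst i; apply: (alt_lt_asym (below y_lt Py')); exists d.
have [e lt_e] := below y_lt Py'.
apply: (inner (minn e d) i y) (lt_at_trans lt_e lt_d) => //; [exact: geq_minr | lia |].
have : P i <> P y by move/(entry_inj lab i_in y_in) => e'; rewrite e' eqxx in niy.
lia.
Qed.

(** This separates the words. If u_c agreed with u_n up to the point where u_n
    leaves the word of its neighbour, then u_c would be on the wrong side of that
    neighbour. *)
Lemma difference_from_last c : 0 < c < n ->
  exists d, lt_at d (tail_from W n) (tail_from W c) \/ lt_at d (tail_from W c) (tail_from W n).
Proof.
move=> c_in.
have n_in : 0 < n <= n by lia.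
have c_in' : 0 < c <= n by lia.
have nPcn : P c <> P n by move/(entry_inj lab c_in' n_in); lia.
case: (ltngtP (P n) (P c)) => [ltP|ltP|]; last by lia.
  have [x x_in Px] : exists2 x, 0 < x <= n & P x = (P n).+1.
    by apply: (entry_onto lab); have := entry_range lab c_in'; lia.
  have x_lt : 0 < x < n.
    by have : x <> n by [move=> e; rewrite e in Px; lia]; lia.
  have [d lt_d] := above x_lt Px.
  have [ecx|ncx] := eqVneq c x; first by exists d; subst c; left.
  have Pxc : P x < P c.
    have : P c <> P x by move/(entry_inj lab c_in' x_in) => e'; rewrite e' eqxx in ncx.
    lia.
  have [agree|[e _ ]] := first_difference (tail_from W n) (tail_from W c) d.+1; last by exists e.
  case: (no_wrong_difference x_in c_in' Pxc (d := d)).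
  by apply: lt_at_eq lt_d => // i le_id; apply: agree.
have [y y_in Py] : exists2 y, 0 < y <= n & P y = (P n).-1.
  by apply: (entry_onto lab); have := entry_range lab c_in'; have := entry_range lab n_in; lia.
have y_lt : 0 < y < n.
  by have : y <> n by [move=> e; rewrite e in Py; have := entry_range lab n_in; lia]; lia.
have [d lt_d] := below y_lt (y := y) ltac:(lia).
have [ecx|ncx] := eqVneq c y; first by exists d; subst c; right.
have Pcy : P c < P y.
  have : P c <> P y by move/(entry_inj lab c_in' y_in) => e'; rewrite e' eqxx in ncx.
  lia.
have [agree|[e _ ]] := first_difference (tail_from W n) (tail_from W c) d.+1; last by exists e.
case: (no_wrong_difference c_in' y_in Pcy (d := d)).
by apply: lt_at_eq lt_d => // i le_id; apply: agree.
Qed.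

(** The tail u_n only has to be placed between the words of the two neighbouring
    values: equal letters are removed until one of the two words is u_n. *)
Lemma order_of_neighbours i j : 0 < i <= n -> 0 < j <= n -> P i < P j ->
  alt_lt (tail_from W i) (tail_from W j).
Proof.
move=> i_in j_in ltP.
suff [d [lt_d|lt_d]] : exists d,
    lt_at d (tail_from W i) (tail_from W j) \/ lt_at d (tail_from W j) (tail_from W i).
- by exists d.
- by case: (no_wrong_difference i_in j_in ltP lt_d).
have [agree|[e _ lt_e]] :=
  first_difference (tail_from W i) (tail_from W j) (n - maxn i j); last by exists e.
have nij : i <> j by move=> e; rewrite e ltnn in ltP.
have sub a b : tail_from (tail_from W a) b =1 tail_from W (a + b).
  by move=> m; rewrite /tail_from addnA.
have [e lt_e] : exists e,
    lt_at e (tail_from W (i + (n - maxn i j))) (tail_from W (j + (n - maxn i j))) \/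
    lt_at e (tail_from W (j + (n - maxn i j))) (tail_from W (i + (n - maxn i j))).
  case: (ltngtP i j) => [lt_ij|lt_ji|//].
    have -> : j + (n - j) = n by lia.
    have [|e [lt_e|lt_e]] := @difference_from_last (i + (n - j)); first lia.
      by exists e; right.
    by exists e; left.
  have -> : i + (n - i) = n by lia.
  have [|e [lt_e|lt_e]] := @difference_from_last (j + (n - i)); first lia.
    by exists e; left.
  by exists e; right.
exists (n - maxn i j + e).
case: lt_e => lt_e.
  have := @lt_at_shift (n - maxn i j) e _ _ agree.
  have {}lt_e := lt_at_eq (fun i _ => esym (sub _ _ i)) (fun i _ => esym (sub _ _ i)) lt_e.
  by move=> /(_ lt_e); case: odd; [right|left].
have agree' m : m < n - maxn i j -> tail_from W j m = tail_from W i m by move/agree.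
have := @lt_at_shift (n - maxn i j) e _ _ agree'.
have {}lt_e := lt_at_eq (fun i _ => esym (sub _ _ i)) (fun i _ => esym (sub _ _ i)) lt_e.
by move=> /(_ lt_e); case: odd; [left|right].
Qed.

End Ordering.

(** * Completing a word by a periodic tail *)

Section Labelling.

Variables (n K : nat) (P z : nat -> nat).
Hypothesis lab : labelling n P z K.

(** Each common letter reverses the comparison. *)
Lemma compare_shift i j l : 0 < i -> 0 < j -> i + l <= n -> j + l <= n ->
  (forall m, m < l -> z (i + m) = z (j + m)) -> P i < P j ->
  if odd l then P (j + l) < P (i + l) else P (i + l) < P (j + l).
Proof.
move=> i_gt0 j_gt0; elim: l => [|l IH] il jl eqz ltP; first by rewrite !addn0.
have {}IH := IH ltac:(lia) ltac:(lia) (fun m lt => eqz m ltac:(lia)) ltP.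
have zl := eqz l (ltnSn l).
rewrite !addnS /=; case: (odd l) IH => /= lt_l.
- by apply: (letter_anti lab) => //; lia.
- by apply: (letter_anti lab) => //; lia.
Qed.

Lemma increasing_gap (f : nat -> nat) b :
  (forall t, t < b -> f t < f t.+1) -> f 0 + b <= f b.
Proof.
elim: b => [|b IH] inc; first by rewrite addn0.
by have := IH (fun t lt => inc t (ltnW lt)); have := inc b (ltnSn b); lia.
Qed.

Lemma decreasing_gap (f : nat -> nat) b :
  (forall t, t < b -> f t.+1 < f t) -> f b + b <= f 0.
Proof.
elim: b => [|b IH] dec; first by rewrite addn0.
by have := IH (fun t lt => dec t (ltnW lt)); have := dec b (ltnSn b); lia.
Qed.

(** Consider the entries read every D positions from y to n. A shift by an even
    number of positions preserves comparisons, so entries two steps apart (or one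
    step apart, for D even) form monotone sequences. Since the first and the last
    entry are consecutive values, three steps are too many. *)
Lemma short_period y a D : 0 < y -> 0 < D -> n = y + a * D ->
  (forall i, y <= i -> i + D < n -> z (i + D) = z i) ->
  P n = (P y).+1 \/ P y = (P n).+1 -> a <= 2.
Proof.
move=> y_gt0 D_gt0 def_n per near; rewrite leqNgt; apply/negP=> a_gt2.
have perM t i : y <= i -> i + t * D < n -> z (i + t * D) = z i.
  elim: t => [|t IH] le_yi lt_n; first by rewrite addn0.
  have -> : i + t.+1 * D = i + t * D + D by rewrite mulSn; lia.
  rewrite per; [|lia|lia].
  by apply: IH; lia.
pose f t := P (y + t * D).
have step t t' m : t + m <= a -> t' + m <= a -> f t < f t' ->
    if odd m && odd D then f (t' + m) < f (t + m) else f (t + m) < f (t' + m).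
  move=> ta t'a lt_f.
  have eqz l : l < m * D -> z (y + t * D + l) = z (y + t' * D + l).
    move=> lt_l; rewrite [y + t * D + l]addnAC [y + t' * D + l]addnAC.
    by rewrite !perM //; nia.
  have := @compare_shift (y + t * D) (y + t' * D) (m * D) _ _ _ _ eqz lt_f.
  rewrite oddM -!addnA -!mulnDl; apply; nia.
have f_inj t t' : t <= a -> t' <= a -> f t = f t' -> t = t'.
  move=> ta t'a /(entry_inj lab) e.
  have /eqP : y + t * D = y + t' * D by apply: e; nia.
  by rewrite eqn_add2l eqn_pmul2r // => /eqP.
have f0 : f 0 = P y by rewrite /f addn0.
have fa : f a = P n by rewrite /f -def_n.
rewrite -f0 -fa in near.
have f01 : f 0 <> f 1 by move/f_inj; lia.
have f02 : f 0 <> f 2 by move/f_inj; lia.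
(* For D even all single steps go in the same direction. *)
case oddD: (odd D) step => step; last first.
  case: (ltngtP (f 0) (f 1)) => [lt01|lt10|//].
    have := @increasing_gap f a; suff inc t : t < a -> f t < f t.+1 by move=> /(_ inc); lia.
    by move=> ta; have := step 0 1 t; rewrite andbF add0n add1n; apply=> //; lia.
  have := @decreasing_gap f a; suff dec t : t < a -> f t.+1 < f t by move=> /(_ dec); lia.
  by move=> ta; have := step 1 0 t; rewrite andbF add0n add1n; apply=> //; lia.
have even_step t t' m : ~~ odd m -> t + m <= a -> t' + m <= a -> f t < f t' ->
    f (t + m) < f (t' + m).
  by move=> /negPf em ta t'a /(step t t' m ta t'a); rewrite em.
have up c : c.*2 <= a -> f 0 < f 2 -> f 0 + c <= f c.*2.
  move=> ca lt02; apply: (@increasing_gap (fun t => f t.*2)) => t tc.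
  have := @even_step 0 2 t.*2; rewrite odd_double /= add0n add2n -doubleS.
  by apply=> //; lia.
have down c : c.*2 <= a -> f 2 < f 0 -> f c.*2 + c <= f 0.
  move=> ca lt02; apply: (@decreasing_gap (fun t => f t.*2)) => t tc.
  have := @even_step 2 0 t.*2; rewrite odd_double /= add0n add2n -doubleS.
  by apply=> //; lia.
have def_a := odd_double_half a.
case odd_a: (odd a) def_a => /= def_a; last first.
  rewrite add0n in def_a.
  have up_a := up a./2 ltac:(lia); have down_a := down a./2 ltac:(lia).
  by rewrite def_a in up_a down_a; lia.
set c := a./2 in def_a.
have c_gt0 : 0 < c by lia.
have f01_last : (f 0 < f 1 -> f c.*2 < f a) /\ (f 1 < f 0 -> f a < f c.*2).
  split=> lt; [have := @even_step 0 1 c.*2 | have := @even_step 1 0 c.*2];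
  by rewrite odd_double /= add0n def_a; apply=> //; lia.
(* For a odd the entries at odd indices move against those at even indices. *)
have odd_up : f 1 < f 3 -> f 1 + c <= f a.
  move=> lt13; rewrite -def_a.
  apply: (@increasing_gap (fun t => f t.*2.+1)) => t tc.
  have := @even_step 1 3 t.*2; rewrite odd_double /= add1n.
  have -> : 3 + t.*2 = t.+1.*2.+1 by lia.
  by apply=> //; lia.
have odd_down : f 3 < f 1 -> f a + c <= f 1.
  move=> lt13; rewrite -def_a.
  apply: (@decreasing_gap (fun t => f t.*2.+1)) => t tc.
  have := @even_step 3 1 t.*2; rewrite odd_double /= add1n.
  have -> : 3 + t.*2 = t.+1.*2.+1 by lia.
  by apply=> //; lia.
have s02 := step 0 2 1 ltac:(lia) ltac:(lia).
have s20 := step 2 0 1 ltac:(lia) ltac:(lia).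
rewrite /= add0n add2n in s02 s20.
have := up c ltac:(lia); have := down c ltac:(lia).
lia.
Qed.

End Labelling.

Definition extend (n : nat) (z t : nat -> nat) : nat -> nat :=
  fun l => if l < n then z l else t (l - n).

Section Interior.

Variables (n K : nat) (P z : nat -> nat).
Hypothesis lab : labelling n P z K.
Variables x y : nat.
Hypotheses (y_gt0 : 0 < y) (lt_yx : y < x) (lt_xn : x < n).
Hypotheses (Py : (P y).+1 = P n) (Px : P x = (P n).+1).
Hypothesis not_square :
  ~ (n - y = (n - x).*2 /\ forall i, i < n - x -> z (y + i) = z (x + i)).

Let m := n - x.

(** The letter read at l when z is continued by repeating z_x ... z_(n-1) is that
    of the position fold l. *)
Let fold l := if l < n then l else x + (l - x) %% m.

Let V l := z (fold l).

Lemma m_gt0 : 0 < m. Proof. by rewrite subn_gt0. Qed.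

Lemma fold_small l : l < n -> fold l = l.
Proof. by rewrite /fold => ->. Qed.

Lemma fold_range l : 0 < l -> 0 < fold l < n.
Proof.
rewrite /fold; case: ifP => [-> -> //|_ _].
by have := ltn_pmod (l - x) m_gt0; have := m_gt0; rewrite /m; lia.
Qed.

Lemma fold_add l : x <= l -> fold (l + m) = fold l.
Proof.
move=> le_xl; rewrite /fold.
have -> : l + m < n = false by rewrite /m; lia.
have -> : l + m - x = (l - x) + m by lia.
rewrite modnDr; case: ifP => // lt_ln.
by rewrite modn_small ?subnKC // /m; lia.
Qed.

Lemma fold_succ l : fold l.+1 = if (fold l).+1 == n then x else (fold l).+1.
Proof.
have [lt_ln|le_nl] := ltnP l n.
  rewrite (fold_small lt_ln); case: eqP => [eq_n|neq_n].
    have -> : l.+1 = x + m by rewrite /m; lia.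
    by rewrite fold_add // fold_small.
  by rewrite fold_small //; lia.
rewrite /fold.
have -> : l.+1 < n = false by lia.
have -> : l < n = false by lia.
have -> : l.+1 - x = (l - x).+1 by lia.
rewrite modnS; set r := (l - x) %% m.
have r_lt : r < m by apply/ltn_pmod/m_gt0.
case: ifP => dvd.
  have /eqP : (l - x).+1 %% m = 0 by apply/eqP.
  rewrite modnS dvd => _.
  have : r.+1 = m.
    apply/eqP; rewrite eqn_leq r_lt /=; apply: dvdn_leq => //.
    by move: dvd; rewrite -addn1 /dvdn -modnDml -/r addn1.
  by case: eqP; rewrite /m; lia.
have : r.+1 <> m.
  move=> rm; move: dvd; rewrite -addn1 /dvdn -modnDml -/r addn1 rm modnn.
  by [].
by case: eqP; rewrite /m; lia.
Qed.

(** As long as the letters agree, the two reading positions compare with a sign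
    that alternates. Going from n back to x does not disturb it: P n is replaced
    by the next value, which compares in the same way with every third value. *)
Lemma sign_tracking e :
  (forall i, i < e -> V (y + i) = V (x + i)) -> fold (y + e) <> fold (x + e) ->
  if odd e then P (fold (x + e)) < P (fold (y + e))
  else P (fold (y + e)) < P (fold (x + e)).
Proof.
elim: e => [|e IH] agree.
  by rewrite !addn0 !fold_small //=; lia.
rewrite !addnS => neq.
have neq' : fold (y + e) <> fold (x + e) by move=> e'; apply: neq; rewrite !fold_succ e'.
have {IH} := IH (fun i lt => agree i (ltnW lt)) neq'.
have := agree e (ltnSn e); rewrite /V.
have := @fold_range (y + e) ltac:(lia); have := @fold_range (x + e) ltac:(lia).
move: neq; rewrite !fold_succ /=.
move: (fold (y + e)) (fold (x + e)) neq' => a b neq' neq b_in a_in eq_z.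
have main u v : 0 < u < n -> 0 < v < n -> z u = z v -> u <> v ->
    (if u.+1 == n then x else u.+1) <> (if v.+1 == n then x else v.+1) ->
    P u < P v ->
    P (if v.+1 == n then x else v.+1) < P (if u.+1 == n then x else u.+1).
  move=> u_in v_in zuv nuv ne ltP; have := letter_anti lab u_in v_in ltP zuv.
  move: ne; case: eqP => [eu|nu]; case: eqP => [ev|nv]; try lia.
  - by rewrite eu => ne lt; lia.
  - rewrite ev Px => ne lt.
    have : P u.+1 <> P x by move/(entry_inj lab); lia.
    by lia.
by case: (odd e) => /=; apply: main => //; exact: nesym.
Qed.

(** If the two words agreed, both p = z_x ... z_(n-1) and q = z_y ... z_(n-1)
    would be powers of a word whose length is the gcd of theirs. By short_period
    the exponent of the longer word q is then 2, that is q = p p. *)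
Lemma periodic_tail_lt : exists2 d, d < n - y & lt_at d (tail_from V y) (tail_from V x).
Proof.
have [agree|[e lt_e [lt|lt]]] := first_difference (tail_from V y) (tail_from V x) (n - y);
  [|by exists e|]; last first.
  case: lt => agree; rewrite /tail_from in agree *.
  have sg := @sign_tracking e (fun i lt => esym (agree i lt)).
  have y_in := @fold_range (y + e) ltac:(lia).
  have x_in := @fold_range (x + e) ltac:(lia).
  have up := letter_mono lab y_in x_in; have dn := letter_mono lab x_in y_in.
  rewrite /V; case: (fold (y + e) =P fold (x + e)) => [->|neq].
    by rewrite ltnn if_same.
  by have := sg neq; case: (odd e) => [/dn|/up]; lia.
have agree_all i : V (y + i) = V (x + i).
  elim/ltn_ind: i => i IH; have [/agree //|le_i] := ltnP i (n - y).
  have -> : y + i = y + (i - m) + m by rewrite /m; lia.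
  have -> : x + i = x + (i - m) + m by rewrite /m; lia.
  by rewrite /V !fold_add; [apply: IH; have := m_gt0; rewrite /m; lia | lia | rewrite /m; lia].
have Vm i : V (x + i + m) = V (x + i) by rewrite /V fold_add //; lia.
have VQ i : V (x + i + (n - y)) = V (x + i).
  rewrite -addnA -agree_all.
  have -> : y + (i + (n - y)) = x + i + m by rewrite /m; lia.
  exact: Vm.
have mul k p i : (forall j, V (x + j + p) = V (x + j)) -> V (x + (i + k * p)) = V (x + i).
  move=> Vp; elim: k => [|k IH]; first by rewrite addn0.
  have -> : x + (i + k.+1 * p) = x + (i + k * p) + p by rewrite mulSn; lia.
  by rewrite Vp.
set g := gcdn m (n - y).
have Vg i : V (x + (i + g)) = V (x + i).
  have [u v eq_uv _] := @egcdnP m (n - y) m_gt0.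
  have <- : V (x + (i + g + v * (n - y))) = V (x + (i + g)) by apply: mul.
  have -> : i + g + v * (n - y) = i + u * m by rewrite eq_uv /g; lia.
  exact: mul.
have g_gt0 : 0 < g by rewrite gcdn_gt0 m_gt0.
have /dvdnP[b def_b] : g %| n - y by apply: dvdn_gcdr.
have /dvdnP[a def_a] : g %| m by apply: dvdn_gcdl.
have b_le2 : b <= 2.
  apply: (@short_period n K P z lab y b g) => //; first by lia.
    move=> i le_yi lt_n.
    have -> : z (i + g) = V (i + g) by rewrite /V fold_small.
    have -> : z i = V i by rewrite /V fold_small //; lia.
    have -> : i + g = y + (i - y + g) by lia.
    have -> : i = y + (i - y) by lia.
    by rewrite !agree_all addKn Vg.
  by left.
have lt_mq : m < n - y by rewrite /m; lia.
have a1 : a = 1 by nia.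
have b2 : b = 2 by nia.
case: not_square; split; first by rewrite -/m; lia.
move=> i lt_i; have := agree_all i; rewrite /V !fold_small //; rewrite -/m in lt_i; rewrite /m in lt_i; lia.
Qed.

(** The tail starts as p p p ... for long enough to inherit the inequality of
    periodic_tail_lt. After an even number of copies of p, comparing it with p
    followed by itself amounts to comparing the smallest word with p p p ..., which
    is larger since there is even a word below it. *)
Lemma interior_tail : exists t : nat -> nat,
  [/\ forall i, t i <= K,
      alt_lt (tail_from (extend n z t) y) (tail_from (extend n z t) n)
    & alt_lt (tail_from (extend n z t) n) (tail_from (extend n z t) x)].
Proof.
have [d lt_d lt_yx_d] := periodic_tail_lt.
have V_le l : 0 < l -> V l <= K by move=> /fold_range; apply: letter_le lab _.
(* A periodic word equal to min_word up to d could not be above another at d. *)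
have [e le_ed lt_e] : exists2 e, e <= d & lt_at e (min_word K) (tail_from V x).
  have [agree|[e lt_ed [lt_e|lt_e]]] :=
    first_difference (min_word K) (tail_from V x) d.+1; last 2 first.
  - by exists e.
  - case: lt_e => _; rewrite /min_word /max_word /tail_from.
    by have := V_le (x + e) ltac:(lia); case: odd; lia.
  case: lt_yx_d => _; rewrite -(agree d (ltnSn d)) /min_word /max_word /tail_from.
  by have := V_le (y + d) ltac:(lia); case: odd; lia.
pose T := (n * m).*2.
pose t i := if i < T then V (x + i) else min_word K (i - T).
have VT i : V (x + (i + T)) = V (x + i).
  rewrite /T -muln2 mulnAC; elim: (n * 2) => [|k IH]; first by rewrite addn0.
  have -> : x + (i + k.+1 * m) = x + (i + k * m) + m by rewrite mulSn; lia.
  by rewrite /V fold_add //; lia.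
have tV i : i < T + e -> t i = V (x + i).
  rewrite /t; case: (ltnP i T) => // le_Ti lt_i.
  rewrite (lt_e.1 (i - T)) ?ltn_subLR //.
  by rewrite /tail_from -(VT (i - T)) subnK.
exists t; set W := extend n z t.
have WV l : 0 < l -> l < n + T + e -> W l = V l.
  rewrite /W /extend; case: (ltnP l n) => [lt_ln _ _|le_nl l_gt0 lt_l].
    by rewrite /V fold_small.
  rewrite tV; last by lia.
  have -> : l = x + (l - n) + m by rewrite /m; lia.
  by rewrite /V fold_add ?addnK; [congr (z (fold _)); rewrite /m; lia | lia].
have Wn i : tail_from W n i = t i by rewrite /tail_from /W /extend ltnNge leq_addr addKn.
have T_gt : n <= T by rewrite /T; nia.
split.
- move=> i; rewrite /t; case: ifP => _; first by apply: V_le; lia.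
  exact: leq_subr.
- exists d; apply: lt_at_eq lt_yx_d => i le_id.
    by rewrite /tail_from WV //; lia.
  by rewrite Wn tV //; lia.
- exists (T + e); split=> [i lt_i|].
    by rewrite Wn tV // /tail_from WV //; have := m_gt0; rewrite /m; lia.
  have tTe : t (T + e) = min_word K e by rewrite /t ltnNge leq_addr addKn.
  rewrite Wn tTe /tail_from WV; [|lia|have := m_gt0; rewrite /m; lia].
  rewrite [T + e]addnC VT oddD.
  have -> : odd T = false by rewrite odd_double.
  by rewrite addbF; case: lt_e.
Qed.

End Interior.

(** * Completing a word in general *)

Definition separating (n : nat) (P z : nat -> nat) (K : nat) (t : nat -> nat) :=
  [/\ forall i, t i <= K,
      forall x, 0 < x < n -> P x = (P n).+1 ->
        alt_lt (tail_from (extend n z t) n) (tail_from (extend n z t) x)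
    & forall y, 0 < y < n -> (P y).+1 = P n ->
        alt_lt (tail_from (extend n z t) y) (tail_from (extend n z t) n)].

Lemma separating_complement n P z K t : 0 < n -> labelling n P z K ->
  separating n (fun i => n.+1 - P i) (fun i => K - z i) K t ->
  separating n P z K (fun i => K - t i).
Proof.
move=> n_gt0 lab [t_le above below].
have rg := entry_range lab.
have rgn := rg n ltac:(lia).
have W'_le l : 0 < l -> extend n (fun i => K - z i) t l <= K.
  by move=> l_gt0; rewrite /extend; case: ifP; rewrite ?leq_subr.
have WW' l : 0 < l -> extend n z (fun i => K - t i) l = K - extend n (fun i => K - z i) t l.
  move=> l_gt0; rewrite /extend; case: ifP => // lt_ln.
  by rewrite subKn //; apply: (letter_le lab); rewrite l_gt0.
have flip a b : 0 < a -> 0 < b ->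
    alt_lt (tail_from (extend n (fun i => K - z i) t) a)
           (tail_from (extend n (fun i => K - z i) t) b) ->
    alt_lt (tail_from (extend n z (fun i => K - t i)) b)
           (tail_from (extend n z (fun i => K - t i)) a).
  move=> a_gt0 b_gt0 [d lt_d]; exists d.
  have := @lt_at_complement K d _ _ _ _ lt_d.
  move/(_ (fun i => W'_le (a + i) ltac:(lia))) => /(_ (fun i => W'_le (b + i) ltac:(lia))).
  by apply: lt_at_eq => i _; rewrite /tail_from WW' //; lia.
split=> [i|x x_in Px|y y_in Py]; first exact: leq_subr.
- apply: flip; [lia|lia|]; apply: below => //=.
  by have := rg x ltac:(lia); lia.
- apply: flip; [lia|lia|]; apply: above => //=.
  by have := rg y ltac:(lia); lia.
Qed.

Section Tails.

Variables (n K : nat) (P z : nat -> nat).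
Hypotheses (n_ge3 : 3 <= n) (lab : labelling n P z K).

(** The largest word can only fail to separate if it is equal to the word of the
    value n - 1. Then z alternates between K and 0 from y on, and since the values
    1 and n - 1 have the extreme letters, this forces P (n - 1) = 1 and y = n - 2,
    the excluded corner. *)
Lemma top_tail : P n = n ->
  ~ [/\ P (n - 2) = n.-1, P (n - 1) = 1, z (n - 2) = K & z (n - 1) = 0] ->
  separating n P z K (max_word K).
Proof.
move=> Pn not_corner; split=> [i|x x_in Px|y y_in Py]; first exact: max_word_le.
  by have := entry_range lab (i := x) ltac:(lia); lia.
set W := extend n z (max_word K).
have Wn i : tail_from W n i = max_word K i.
  by rewrite /tail_from /W /extend ltnNge leq_addr addKn.
have W_le i : tail_from W y i <= K.
  rewrite /tail_from /W /extend; case: ifP => [lt_n|_]; last exact: max_word_le.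
  by apply: (letter_le lab); lia.
have [agree|[d _ [lt_d|lt_d]]] :=
  first_difference (tail_from W y) (tail_from W n) (n - y).+1; last 2 first.
- by exists d.
- by case: (max_word_maximal W_le (Wn d) lt_d).
case: not_corner.
have zy i : i < n - y -> z (y + i) = max_word K i.
  move=> lt_i; have := agree i ltac:(lia); rewrite Wn => <-.
  by rewrite /tail_from /W /extend ifT //; lia.
have parity : odd (n - y) -> K = 0.
  move=> odd_q; have := agree (n - y) (ltnSn _); rewrite Wn /tail_from subnKC; last by lia.
  by rewrite /W /extend ltnn subnn /max_word odd_q.
have z1 : z (n - 1) = 0.
  have := zy (n - 1 - y) ltac:(lia).
  have -> : y + (n - 1 - y) = n - 1 by lia.
  rewrite /max_word => ->; case: ifP => // even_q; apply: parity.
  have -> : n - y = (n - 1 - y).+1 by lia.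
  by rewrite /= even_q.
have rg := entry_range lab.
have [a a_in Pa] := @entry_onto _ _ _ _ lab 1 ltac:(lia).
have a_n : a <> n by move=> e; rewrite e in Pa; lia.
(* Otherwise the entry after 1 would be above the entry after P (n - 1), which is n. *)
have ea : a = n - 1.
  have [//|na] := eqVneq a (n - 1).
  have nPa : P a <> P (n - 1) by move/(entry_inj lab); lia.
  have ltP : P a < P (n - 1) by have := rg (n - 1) ltac:(lia); lia.
  have z_le := letter_mono lab (i := a) (j := n - 1) ltac:(lia) ltac:(lia) ltP.
  have := letter_anti lab (i := a) (j := n - 1) ltac:(lia) ltac:(lia) ltP ltac:(lia).
  have -> : (n - 1).+1 = n by lia.
  by have := rg a.+1 ltac:(lia); lia.
subst a.
have y_n1 : y <> n - 1 by move=> e; rewrite e in Py; lia.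
have z2 : z (n - 2) = K.
  have := zy (n - 2 - y) ltac:(lia).
  have -> : y + (n - 2 - y) = n - 2 by lia.
  rewrite /max_word => ->; case: ifP => // odd_q; rewrite parity //.
  have -> : n - y = (n - 2 - y).+2 by lia.
  by rewrite /= odd_q.
have zy0 : z y = K by rewrite -[y]addn0 zy //; lia.
split=> //; have [<-|ny] := eqVneq y (n - 2); first lia.
have nP2y : P (n - 2) <> P y by move/(entry_inj lab); lia.
have nP2n : P (n - 2) <> P n by move/(entry_inj lab); lia.
have ltP : P (n - 2) < P y by have := rg (n - 2) ltac:(lia); lia.
have := letter_anti lab (i := n - 2) (j := y) ltac:(lia) ltac:(lia) ltP ltac:(lia).
have -> : (n - 2).+1 = n - 1 by lia.
by have := rg y.+1 ltac:(lia); lia.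
Qed.

End Tails.

(** The interior case with x < y is the complement of the one with y < x. *)
Theorem realization n K P z : 3 <= n -> labelling n P z K ->
  ~ [/\ P (n - 2) = n.-1, P (n - 1) = 1, P n = n, z (n - 2) = K & z (n - 1) = 0] ->
  ~ [/\ P (n - 2) = 2, P (n - 1) = n, P n = 1, z (n - 2) = 0 & z (n - 1) = K] ->
  (forall x y, 0 < x < n -> 0 < y < n -> P x = (P n).+1 -> (P y).+1 = P n ->
    ~ (n - y = (n - x).*2 /\ forall i, i < n - x -> z (y + i) = z (x + i)) /\
    ~ (n - x = (n - y).*2 /\ forall i, i < n - y -> z (x + i) = z (y + i))) ->
  exists t, separating n P z K t.
Proof.
move=> n_ge3 lab corner1 corner2 not_square.
have lab' := labelling_complement lab.
have rg := entry_range lab; have rgn := rg n ltac:(lia).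
have rg1 := rg (n - 1) ltac:(lia); have rg2 := rg (n - 2) ltac:(lia).
have [Pn|Pn] := eqVneq (P n) n.
  exists (max_word K); apply: top_tail => // -[P2 P1 z2 z1].
  by apply: corner1; split.
have [Pn1|Pn1] := eqVneq (P n) 1.
  exists (fun i => K - max_word K i); apply: separating_complement => //; first lia.
  apply: top_tail => //; first by rewrite Pn1; lia.
  case=> P2 P1 z2 z1; apply: corner2.
  have := letter_le lab (i := n - 2) ltac:(lia); have := letter_le lab (i := n - 1) ltac:(lia).
  by split; lia.
have neighbour v : 0 < v <= n -> v != P n -> exists2 i, 0 < i < n & P i = v.
  move=> v_in nv; have [i i_in Pi] := entry_onto lab v_in; exists i => //.
  by have : i <> n by [move=> e; rewrite -Pi e eqxx in nv]; lia.
have [x x_in Px] := neighbour (P n).+1 ltac:(lia) ltac:(lia).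
have [y y_in Py] := neighbour (P n).-1 ltac:(lia) ltac:(lia).
have Py' : (P y).+1 = P n by lia.
have [nsq1 nsq2] := not_square x y x_in y_in Px Py'.
have same i j : 0 < i < n -> 0 < j < n -> P i = P j -> i = j.
  by move=> i_in j_in; apply: (entry_inj lab); lia.
have nxy : x <> y by move=> e; rewrite e in Px; lia.
have [lt_yx|le_xy] := ltnP y x.
  have [t [t_le lt_y lt_x]] := @interior_tail n K P z lab x y ltac:(lia) lt_yx ltac:(lia) Py' Px nsq1.
  exists t; split=> // [x' x'_in Px'|y' y'_in Py''].
    by rewrite (same x' x) //; lia.
  by rewrite (same y' y) //; lia.
have Px_c : (n.+1 - P x).+1 = n.+1 - P n by have := rg x ltac:(lia); lia.
have Py_c : n.+1 - P y = (n.+1 - P n).+1 by have := rg y ltac:(lia); lia.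
have [|t [t_le lt_y lt_x]] := interior_tail lab' (x := y) (y := x) ltac:(lia) ltac:(lia) ltac:(lia) Px_c Py_c.
  case=> eq_n eq_z; apply: nsq2; split=> // i lt_i.
  have := eq_z i lt_i; have := letter_le lab (i := x + i) ltac:(lia); have := letter_le lab (i := y + i) ltac:(lia).
  lia.
exists (fun i => K - t i); apply: separating_complement => //; first lia.
split=> // [x' x'_in Px'|y' y'_in Py''].
  by rewrite (same x' y) //; have := rg x' ltac:(lia); lia.
by rewrite (same y' x) //; have := rg y' ltac:(lia); lia.
Qed.

(** * Blocks of the marked cycle *)

Lemma pairwise_pmap (S T : Type) (r : rel T) (f : S -> option T) (s : seq S) :
  pairwise r (pmap f s) =
  pairwise (fun x y => oapp (fun a => oapp (r a) true (f y)) true (f x)) s.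
Proof.
elim: s => //= x s <-; case: (f x) => [a|] /=; last first.
  by rewrite all_predT.
congr (_ && _); elim: s => //= y s IH.
by case: (f y) => //= b; rewrite IH.
Qed.

Lemma crossing (e : nat -> nat) k v : e 0 < v -> v <= e k ->
  exists2 t, t < k & e t < v <= e t.+1.
Proof.
elim: k => [|k IH] lt0 le_k; first by move: (leq_trans lt0 le_k); rewrite ltnn.
have [lt_k|ge_k] := ltnP (e k) v; first by exists k; rewrite ?lt_k.
by have [t lt_t ?] := IH lt0 ge_k; exists t => //; apply: ltnW.
Qed.

Lemma nth_lt_count s v i : sorted leq s -> i < size s ->
  (nth 0 s i < v) = (i < count (fun a => a < v) s).
Proof.
elim: s i => //= a s IH i sorted_as lt_i.
have /allP min_a := order_path_min leq_trans sorted_as.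
have sorted_s := path_sorted sorted_as.
have [lt_av|le_va] := ltnP a v; first by case: i lt_i => [|i] /= lt_i; rewrite ?lt_av // IH.
have -> : count (fun a0 => a0 < v) s = 0.
  apply/eqP; rewrite -leqn0 leqNgt -has_count; apply/hasP=> -[b /min_a /= le_ab]; rewrite ltnNge (leq_trans le_va le_ab) //.
rewrite addn0 /= ltn0; case: i lt_i => [|i] lt_i /=; first by rewrite ltnNge le_va.
by apply/negbTE; rewrite -leqNgt (leq_trans le_va) // min_a // mem_nth.
Qed.

Lemma squareP (z : nat -> nat) n a b : a <= n -> b <= n ->
  let tail i := [seq z l | l <- iota i (n - i)] in
  reflect (n - a = (n - b).*2 /\ forall i, i < n - b -> z (a + i) = z (b + i))
          (tail a == tail b ++ tail b).
Proof.
move=> le_an le_bn tail; rewrite /tail; set m := n - b.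
have [eq_len|neq_len] := eqVneq (n - a) m.*2; last first.
  apply: (iffP eqP) => [/(congr1 size)|[eq_len]]; last by rewrite eq_len eqxx in neq_len.
  by rewrite size_cat !size_map !size_iota => e; rewrite e addnn eqxx in neq_len.
rewrite eq_len -addnn iotaD map_cat eqseq_cat ?size_map ?size_iota //.
have -> : a + m = b by rewrite /m in eq_len *; lia.
rewrite eqxx andbT; apply: (iffP eqP) => [eq_map|[_ eq_z]].
  split=> // i lt_i; have := congr1 (fun s => nth 0 s i) eq_map.
  by rewrite !(nth_map 0) ?size_iota // !nth_iota.
apply: (@eq_from_nth _ 0) => [|i]; first by rewrite !size_map !size_iota.
rewrite size_map size_iota => lt_i.
by rewrite !(nth_map 0) ?size_iota // !nth_iota // eq_z.
Qed.

Section OneLineTheory.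

Variable pi : seq nat.
Hypothesis pi_perm : perm_eq pi (iota 1 (size pi)).

Local Notation n := (size pi).
Local Notation P := (entry pi).

Lemma pi_uniq : uniq pi.
Proof. by rewrite (perm_uniq pi_perm) iota_uniq. Qed.

Lemma mem_pi v : (v \in pi) = (0 < v <= n).
Proof. by rewrite (perm_mem pi_perm) mem_iota add1n ltnS. Qed.

Lemma entry_bounds i : 0 < i <= n -> 0 < P i <= n.
Proof.
case: i => // i /=; rewrite /entry /= => lt_i.
by rewrite -mem_pi mem_nth.
Qed.

Lemma entry_injective i j : 0 < i <= n -> 0 < j <= n -> P i = P j -> i = j.
Proof.
case: i => // i; case: j => // j /= lt_i lt_j; rewrite /entry /= => /eqP.
by rewrite nth_uniq ?pi_uniq // => /eqP ->.
Qed.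

Lemma position_bounds v : 0 < v <= n -> 0 < position pi v <= n.
Proof.
by rewrite /position /= => v_in; case: eqP => [|_]; [lia | rewrite index_mem mem_pi].
Qed.

Lemma positionK v : 0 < v <= n -> P (position pi v) = v.
Proof.
rewrite /position /entry /= => v_in; case: eqP => [|_]; first lia.
by rewrite /= nth_index // mem_pi.
Qed.

Lemma entryK i : 0 < i <= n -> position pi (P i) = i.
Proof.
move=> i_in; apply: entry_injective => //; last by rewrite positionK ?entry_bounds.
by rewrite position_bounds ?entry_bounds.
Qed.

Lemma entry_surjective v : 0 < v <= n -> exists2 i, 0 < i <= n & P i = v.
Proof. by exists (position pi v); rewrite ?position_bounds ?positionK. Qed.

Lemma hat_star_entry i : 0 < i <= n ->
  hat_star pi (P i) = if i < n then Some (P i.+1) else None.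
Proof. by move=> i_in; rewrite /hat_star entryK. Qed.

(** Indexing the entries of the block by the positions of their values disposes
    of the star: it is the entry at the value P n, whose position n is excluded. *)
Lemma decreasing_blockP a b : b <= n ->
  reflect (forall i j, 0 < i < n -> 0 < j < n ->
             a < P i -> P i < P j -> P j <= b -> P j.+1 < P i.+1)
          (decreasing_block pi a b).
Proof.
move=> le_bn; rewrite /decreasing_block sorted_pairwise ?pairwise_pmap; last first.
  by move=> u v w /=; lia.
apply: (iffP (pairwiseP 0)) => [dec i j i_in j_in lt_ai lt_ij le_jb | dec u v].
  have := dec (P i - a.+1) (P j - a.+1); rewrite !inE size_iota.
  move=> /(_ ltac:(lia) ltac:(lia) ltac:(lia)).
  rewrite !nth_iota; [|lia|lia].
  rewrite !subnKC; [|lia|lia].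
  rewrite !hat_star_entry; [|lia|lia].
  by have [-> ->] : i < n /\ j < n by lia.
rewrite !inE size_iota => lt_u lt_v lt_uv; rewrite !nth_iota //.
have [i i_in ePi] := @entry_surjective (a.+1 + u) ltac:(lia).
have [j j_in ePj] := @entry_surjective (a.+1 + v) ltac:(lia).
rewrite -ePi -ePj !hat_star_entry //.
case: ifP => // lt_i; case: ifP => // lt_j /=.
by apply: dec; lia.
Qed.

Section Segmentation.

Variable I : seq nat.
Hypotheses (sorted_I : sorted leq I) (I_le : all (fun e => e <= n) I).

Let E := 0 :: rcons I n.

Lemma segmentation_sorted : sorted leq E.
Proof.
rewrite /E /=; move: sorted_I I_le; case: (I) => [|e J] //= sorted_J.
move=> /andP[le_en le_J]; rewrite rcons_path sorted_J /=.
by case/lastP: J le_J {sorted_J} => [|J e'] //=; rewrite all_rcons last_rcons => /andP[].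
Qed.

Lemma segmentation_mono s t : s <= t -> t <= (size I).+1 -> nth 0 E s <= nth 0 E t.
Proof.
move=> le_st le_t; apply: (sorted_leq_nth leq_trans leqnn 0 segmentation_sorted) => //;
by rewrite inE /E /= size_rcons; lia.
Qed.

Lemma nth_segmentation t : t < size I -> nth 0 E t.+1 = nth 0 I t.
Proof. by move=> lt_t; rewrite /E /= nth_rcons lt_t. Qed.

Lemma nth_segmentation_last : nth 0 E (size I).+1 = n.
Proof. by rewrite /E /= nth_rcons ltnn eqxx. Qed.

Lemma segmentation_le t : nth 0 E t <= n.
Proof.
case: t => [|t]; first by [].
rewrite /E /= nth_rcons; case: ltnP => [lt_t|_]; last by case: eqP.
by apply: (allP I_le); apply: mem_nth.
Qed.

Lemma prefix_letterP i : 0 < i <= n ->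
  prefix_letter pi E i <= size I /\
  nth 0 E (prefix_letter pi E i) < P i <= nth 0 E (prefix_letter pi E i).+1.
Proof.
move=> /entry_bounds Pi_in; rewrite /prefix_letter.
have -> : (size E).-1 = (size I).+1 by rewrite /= size_rcons.
set p := fun j => _.
have has_p : has p (iota 0 (size I).+1).
  have [|t lt_t e_t] := @crossing (nth 0 E) (size I).+1 (P i) ltac:(rewrite /=; lia).
    by rewrite nth_segmentation_last; lia.
  by apply/hasP; exists t => //; rewrite mem_iota.
have := has_p; rewrite has_find size_iota => lt_f; split; first by rewrite -ltnS.
by have := nth_find 0 has_p; rewrite nth_iota.
Qed.

(** Counting the cuts below a value makes the effect of an additional cut
    visible. *)
Lemma prefix_letter_count i : 0 < i <= n ->
  prefix_letter pi E i = count (fun e => e < P i) I.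
Proof.
move=> /prefix_letterP[]; move: (prefix_letter pi E i) => t le_t /andP[lt_e le_e].
apply/eqP; rewrite eqn_leq; apply/andP; split.
  case: t le_t lt_e {le_e} => // t lt_t; rewrite nth_segmentation //.
  by rewrite nth_lt_count.
have [eq_t|lt_t] : t = size I \/ t < size I by lia.
  by rewrite eq_t count_size.
by move: le_e; rewrite nth_segmentation // leqNgt nth_lt_count // -leqNgt.
Qed.

(** Two entries next to each other, possibly with the star in between, are
    separated by a cut if they increase. When the star is in between, there are two
    places for this cut, the ascent and P n, which is why P n is ruled out. *)
Lemma decreasing_blocks_ascents : P n \notin I ->
  all (fun t => decreasing_block pi (nth 0 E t) (nth 0 E t.+1)) (iota 0 (size I).+1)
  = all (mem I) (ascents pi).
Proof.
move=> star_notin; apply/idP/idP => [/allP dec | /allP asc_in].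
  apply/allP=> j; rewrite mem_filter mem_iota => /andP[asc_j j_in].
  have [|t lt_t /andP[lt_ej le_je]] := @crossing (nth 0 E) (size I).+1 j ltac:(rewrite /=; lia).
    by rewrite nth_segmentation_last; lia.
  have /(decreasing_blockP (nth 0 E t) (segmentation_le _)) dec_t := dec t ltac:(by rewrite mem_iota).
  have [i i_in ePi] := @entry_surjective j ltac:(lia).
  have [i' i'_in ePi'] := @entry_surjective j.+1 ltac:(lia).
  have eI : t < size I -> j = nth 0 E t.+1 -> j \in I.
    by move=> lt_tI ->; rewrite nth_segmentation // mem_nth.
  apply: contraT => notin.
  have lt_je : j < nth 0 E t.+1.
    rewrite ltn_neqAle le_je andbT; apply/eqP=> ej.
    have [lt_tI|ge_tI] := ltnP t (size I); first by case/negP: notin; apply: eI.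
    have et : t = size I by lia.
    by move: ej; rewrite et nth_segmentation_last; lia.
  move: asc_j; rewrite /ascent -ePi' -ePi !hat_star_entry //.
  case: ifP => // lt_in; case: ifP => [lt_i'n | ge_i'n].
    have := dec_t i i' ltac:(lia) ltac:(lia) ltac:(lia) ltac:(lia) ltac:(lia).
    by lia.
  have ei' : i' = n by lia.
  have [i2n|//] := leqP (P i').+1 n.
  have [i2 i2_in ePi2] := @entry_surjective (P i').+1 ltac:(lia).
  rewrite -ePi2 hat_star_entry //; case: ifP => [lt_i2|]; last by rewrite andbF.
  have lt_j2 : j.+1 < nth 0 E t.+1.
    rewrite ltn_neqAle lt_je andbT; apply/eqP=> ej.
    have [lt_tI|ge_tI] := ltnP t (size I).
      by move: star_notin; rewrite -ei' ePi' ej nth_segmentation // mem_nth.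
    have et : t = size I by lia.
    by move: ej; rewrite et nth_segmentation_last; lia.
  have := dec_t i i2 ltac:(lia) ltac:(lia) ltac:(lia) ltac:(lia) ltac:(lia).
  by lia.
apply/allP=> t; rewrite mem_iota => t_in; apply/decreasing_blockP; first exact: segmentation_le.
set a := nth 0 E t; set b := nth 0 E t.+1.
have le_bn : b <= n := segmentation_le _.
have no_ascent j : a < j -> j < b -> ~~ ascent pi j.
  move=> lt_aj lt_jb; apply/negP=> asc_j.
  have /asc_in /(nthP 0)[s lt_s e_s] : j \in ascents pi by rewrite mem_filter asc_j mem_iota; lia.
  rewrite -nth_segmentation // in e_s.
  have [le_st|lt_ts] := leqP s.+1 t.
    by have := segmentation_mono le_st ltac:(lia); rewrite e_s -/a; lia.
  by have := segmentation_mono lt_ts (leqW lt_s); rewrite e_s -/b; lia.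
suff main v : v <= b -> forall i j, 0 < i < n -> 0 < j < n -> a < P i -> P i < P j ->
    P j = v -> P j.+1 < P i.+1.
  by move=> i j i_in j_in lt_ai lt_ij le_jb; apply: (main (P j)).
elim/ltn_ind: v => v IH le_vb i j i_in j_in lt_ai lt_ij ePj.
have [l l_in ePl] := @entry_surjective v.-1 ltac:(lia).
have hat_v : hat_star pi v = Some (P j.+1).
  by rewrite -ePj hat_star_entry ?ifT //; lia.
have [lt_ln|ge_ln] := ltnP l n.
  have := no_ascent v.-1 ltac:(lia) ltac:(lia).
  rewrite /ascent prednK; last by lia.
  rewrite hat_v -ePl hat_star_entry // lt_ln -leqNgt => le_P.
  have nP : P j.+1 <> P l.+1 by move/entry_injective => e; have := e ltac:(lia) ltac:(lia); move=> -[e']; subst; lia.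
  have [eil|nil] := eqVneq i l; first by subst i; lia.
  have nPil : P i <> P l by move/entry_injective => e; have := e ltac:(lia) ltac:(lia); lia.
  have := IH v.-1 ltac:(lia) ltac:(lia) i l ltac:(lia) ltac:(lia) lt_ai ltac:(lia) ePl.
  by lia.
have el : l = n by lia.
have niv : P i <> v.-1 by move=> e; have := @entry_injective i l ltac:(lia) ltac:(lia); lia.
have [l2 l2_in ePl2] := @entry_surjective v.-2 ltac:(lia).
have l2n : l2 < n.
  have : l2 <> n by move=> e; subst l2; rewrite el in ePl; lia.
  lia.
have := no_ascent v.-2 ltac:(lia) ltac:(lia).
rewrite /ascent.
have -> : v.-2.+1 = v.-1 by lia.
have -> : v.-1.+1 = v by lia.
rewrite -{1}ePl2 -ePl !hat_star_entry // l2n el ltnn hat_v.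
have -> : v <= n by lia.
rewrite /= -leqNgt => le_P.
have nP : P j.+1 <> P l2.+1 by move/entry_injective => e; have := e ltac:(lia) ltac:(lia); move=> -[e']; subst; lia.
have [eil|nil] := eqVneq i l2; first by subst i; lia.
have nPil : P i <> P l2 by move/entry_injective => e; have := e ltac:(lia) ltac:(lia); lia.
have := IH v.-2 ltac:(lia) ltac:(lia) i l2 ltac:(lia) ltac:(lia) lt_ai ltac:(lia) ePl2.
by lia.
Qed.

End Segmentation.

End OneLineTheory.

(** * From valid segmentations to words *)

Lemma nth_rcons_last (I : seq nat) e : nth 0 (0 :: rcons I e) (size I) = last 0 I.
Proof.
case/lastP: I => [|J a] //.
by rewrite last_rcons size_rcons /= nth_rcons size_rcons ltnSn nth_rcons ltnn eqxx.
Qed.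

Section Segmentations.

Variable pi : seq nat.
Hypothesis pi_perm : perm_eq pi (iota 1 (size pi)).

Local Notation n := (size pi).
Local Notation P := (entry pi).

(** head n I and last 0 I are the entries e_1 and e_(k-1) of the segmentation
    0 :: rcons I n, also when I is empty. *)
Definition corner_condition (I : seq nat) : bool :=
  (ends_with pi n.-1 1 n ==> (head n I == 0) || (last 0 I == n.-1)) &&
  (ends_with pi 2 n 1 ==> (head n I == 0) || (last 0 I == n)).

Lemma neg_segmentationE (I : seq nat) :
  neg_segmentation pi (size I).+1 (0 :: rcons I n) =
  [&& sorted leq I, all (fun e => e <= n) I, P n \notin I,
      all (mem I) (ascents pi) & corner_condition I].
Proof.
rewrite /neg_segmentation /= size_rcons !eqxx /=.
have -> : nth 0 (rcons I n) (size I) = n by rewrite nth_rcons ltnn eqxx.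
rewrite eqxx andbT.
have head_I : nth 0 (rcons I n) 0 = head n I by case: (I).
rewrite !head_I -[nth 0 _ (size I)]/(nth 0 (0 :: rcons I n) (size I)) nth_rcons_last.
have [sorted_I|] := boolP (sorted leq I); last first.
  move=> unsorted; apply/negbTE; apply: contra unsorted => /and5P[path_E _ _ _ _].
  by move: (path_sorted path_E); rewrite -cats1; apply: subseq_sorted leq_trans _ _ (prefix_subseq _ _).
have [I_le|] := boolP (all _ I); last first.
  move=> unbounded; apply/negbTE; apply: contra unbounded => /and5P[path_E _ _ _ _].
  apply/allP=> b b_in.
  have lt_b : index b I < size I by rewrite index_mem.
  have := sorted_leq_nth leq_trans leqnn 0 (path_sorted path_E) (index b I) (size I).
  by rewrite !inE size_rcons !nth_rcons lt_b ltnn eqxx nth_index //; apply; lia.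
have -> /= : path leq 0 (rcons I n) = true by apply: (segmentation_sorted sorted_I I_le).
have -> : all (fun t => nth 0 (0 :: rcons I n) t != P n) (iota 1 (size I)) = (P n \notin I).
  apply/allP/idP => [avoid|notin t].
    apply/negP=> /(nthP 0)[i lt_i e_i]; have := avoid i.+1.
    by rewrite mem_iota (nth_segmentation pi lt_i) e_i eqxx add1n ltnS /= => /(_ lt_i).
  rewrite mem_iota; case: t => // t /andP[_]; rewrite add1n => lt_t.
  rewrite (nth_segmentation pi lt_t); apply: contraNneq notin => <-; exact: mem_nth.
have [notin|/negPf star_in] := boolP (P n \in I); first by rewrite /= !andbF.
have := decreasing_blocks_ascents pi_perm sorted_I I_le (negbT star_in).
by rewrite /= head_I => ->; rewrite andbT /corner_condition andbA.
Qed.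

Lemma neg_segmentation_shape k E : 0 < n -> neg_segmentation pi k E ->
  exists2 I, k = (size I).+1 & E = 0 :: rcons I n.
Proof.
move=> n_gt0 /andP[/eqP size_E /and5P[/andP[/eqP e0 /andP[_ /eqP ek]] _ _ _ _]].
case: E size_E e0 ek => // e E [size_E] /= -> ek.
case/lastP: E size_E ek => [|I e'] <-; first by move=> /= e0; move: n_gt0; rewrite -e0.
rewrite size_rcons /= nth_rcons ltnn eqxx => ->.
by exists I.
Qed.

Section OfSegmentation.

Variable I : seq nat.
Hypothesis seg : neg_segmentation pi (size I).+1 (0 :: rcons I n).

Lemma segmentation_cuts_sorted : sorted leq I.
Proof. by move: seg; rewrite neg_segmentationE => /and5P[]. Qed.

Lemma segmentation_cuts_le : all (fun e => e <= n) I.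
Proof. by move: seg; rewrite neg_segmentationE => /and5P[]. Qed.

Local Notation z := (prefix_letter pi (0 :: rcons I n)).

Lemma segmentation_labelling : labelling n P z (size I).
Proof.
split.
- exact: entry_bounds.
- exact: entry_injective.
- exact: entry_surjective.
- by move=> i i_in; have [] := prefix_letterP pi_perm segmentation_cuts_sorted segmentation_cuts_le (i := i) ltac:(lia).
- move=> i j i_in j_in lt_ij.
  rewrite !(prefix_letter_count pi_perm segmentation_cuts_sorted segmentation_cuts_le); [|lia|lia].
  by apply: sub_count => e /=; lia.
move=> i j i_in j_in lt_ij eq_z.
have [le_i /andP[lt_i _]] := prefix_letterP pi_perm segmentation_cuts_sorted segmentation_cuts_le (i := i) ltac:(lia).
have [_ /andP[_ le_j]] := prefix_letterP pi_perm segmentation_cuts_sorted segmentation_cuts_le (i := j) ltac:(lia).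
rewrite -eq_z in le_j.
have /andP[_ /and5P[_ /allP dec _ _ _]] := seg.
have /dec : z i \in iota 0 (size I).+1 by rewrite mem_iota.
move/(decreasing_blockP pi_perm _ (segmentation_le segmentation_cuts_le _)).
by apply.
Qed.

Lemma segmentation_separating : 3 <= n -> ~~ invalid pi (0 :: rcons I n) ->
  exists t, separating n P z (size I) t.
Proof.
move=> n_ge3 valid; apply: realization => //; first exact: segmentation_labelling.
- case=> P2 P1 Pn z2 z1.
  have ends : ends_with pi n.-1 1 n by rewrite /ends_with n_ge3 P2 P1 Pn !eqxx.
  have := seg; rewrite neg_segmentationE /corner_condition ends => /and5P[_ _ _ _ /andP[/= corner _]].
  have [_] := prefix_letterP pi_perm segmentation_cuts_sorted segmentation_cuts_le (i := n - 1) ltac:(lia).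
  have [_] := prefix_letterP pi_perm segmentation_cuts_sorted segmentation_cuts_le (i := n - 2) ltac:(lia).
  rewrite z1 z2 P1 P2 /= => /andP[lt_last _].
  case/orP: corner => /eqP e_corner.
    have -> : nth 0 (rcons I n) 0 = head n I by case: (I).
    by rewrite e_corner.
  by move: lt_last; rewrite nth_rcons_last e_corner ltnn.
- case=> P2 P1 Pn z2 z1.
  have ends : ends_with pi 2 n 1 by rewrite /ends_with n_ge3 P2 P1 Pn !eqxx.
  have := seg; rewrite neg_segmentationE /corner_condition ends => /and5P[_ _ _ _ /andP[_ /= corner]].
  have [_] := prefix_letterP pi_perm segmentation_cuts_sorted segmentation_cuts_le (i := n - 1) ltac:(lia).
  have [_] := prefix_letterP pi_perm segmentation_cuts_sorted segmentation_cuts_le (i := n - 2) ltac:(lia).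
  rewrite z1 z2 P1 P2 /= => le_head /andP[lt_last _].
  case/orP: corner => /eqP e_corner.
    move: le_head; have -> : nth 0 (rcons I n) 0 = head n I by case: (I).
    by rewrite e_corner.
  by move: lt_last; rewrite nth_rcons_last e_corner ltnn.
move=> x y x_in y_in Px Py.
have n1 : P n != 1 by have := entry_bounds pi_perm (i := y) ltac:(lia); lia.
have nn : P n != n by have := entry_bounds pi_perm (i := x) ltac:(lia); lia.
have ex : xpos pi = x by rewrite /xpos -Px (entryK pi_perm) //; lia.
have ey : ypos pi = y by rewrite /ypos -Py (entryK pi_perm) //; lia.
move: valid; rewrite /invalid n1 nn /= negb_or ex ey => /andP[sq1 sq2].
by split; [move/squareP: sq2; apply | move/squareP: sq1; apply]; lia.
Qed.

End OfSegmentation.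

End Segmentations.

Section Allowed.

Variables (n : nat) (s : 'S_n).

Lemma size_one_line : size (one_line s) = n.
Proof. by rewrite /one_line size_map size_enum_ord. Qed.

Lemma entry_one_line (i : 'I_n) : entry (one_line s) i.+1 = (s i).+1.
Proof.
rewrite /entry /one_line /= (nth_map i) ?size_enum_ord //.
by rewrite nth_ord_enum.
Qed.

Lemma one_line_perm : perm_eq (one_line s) (iota 1 (size (one_line s))).
Proof.
rewrite size_one_line; apply: uniq_perm; rewrite ?iota_uniq //.
  rewrite map_inj_uniq ?enum_uniq // => i j [/val_inj]; exact: perm_inj.
move=> v; rewrite mem_iota add1n ltnS; apply/mapP/andP => [[i _ ->]|[v_gt0 v_le]].
  by rewrite ltn_ord.
have v_lt : v.-1 < n by lia.
exists (s^-1%g (Ordinal v_lt)); first by rewrite mem_enum.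
by rewrite permKV /= prednK.
Qed.

Definition letters (k : nat) (w : word k) : nat -> nat := fun l => w l.-1.

Lemma word_lt_alt k (v w : word k) :
  word_lt v w <-> alt_lt (fun i => v i : nat) (fun i => w i : nat).
Proof.
have sign j : ((0 < (-1) ^+ j * ((w j)%:Z - (v j)%:Z) :> int)%R =
    if odd j then w j < v j else v j < w j).
  by rewrite -GRing.signr_odd; case: (odd j) => /=; rewrite ?GRing.expr0 ?GRing.expr1; lia.
split=> -[j [agree lt_j]]; exists j.
  by split=> [i /agree -> //|]; rewrite -sign.
by split=> [i /agree e|]; [apply: val_inj | rewrite sign].
Qed.

Lemma iter_neg_shift k (w : word k) i m : iter i (@neg_shift k) w m = w (i + m).
Proof. by elim: i m => [|i IH] m //; rewrite iterS /neg_shift IH addnS. Qed.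

Lemma neg_shift_lt k (w : word k) (i j : nat) :
  word_lt (iter i (@neg_shift k) w) (iter j (@neg_shift k) w) <->
  alt_lt (tail_from (letters w) i.+1) (tail_from (letters w) j.+1).
Proof.
rewrite word_lt_alt; split=> -[d lt_d]; exists d; apply: lt_at_eq lt_d => m _;
by rewrite /tail_from /letters addSn /= iter_neg_shift.
Qed.

Lemma valid_segmentation_allowed k E : 3 <= n ->
  valid_neg_segmentation (one_line s) k E -> allow_neg_shift k s.
Proof.
move=> n_ge3 /andP[seg valid].
have szn := size_one_line; have pi_perm := one_line_perm.
have n_ge3' : 3 <= size (one_line s) by rewrite szn.
have [I ek eE] := neg_segmentation_shape (ltnW (ltnW n_ge3')) seg.
rewrite {k}ek {E}eE in seg valid *.
have lab := segmentation_labelling pi_perm seg.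
have [t [t_le above below]] := segmentation_separating pi_perm seg n_ge3' valid.
set z := prefix_letter _ _ in lab above below.
rewrite szn in lab above below.
pose W := extend n z t.
have W_le l : 0 < l -> W l <= size I.
  rewrite /W /extend; case: ifP => // lt_ln l_gt0.
  by apply: (letter_le lab); rewrite l_gt0.
have order : forall i j, 0 < i <= n -> 0 < j <= n ->
    entry (one_line s) i < entry (one_line s) j -> alt_lt (tail_from W i) (tail_from W j).
  apply: (order_of_neighbours (W := W) lab) above below => l /andP[_ lt_l].
  by rewrite /W /extend lt_l.
pose w : word (size I).+1 := fun l => inord (W l.+1).
have letters_w l : 0 < l -> letters w l = W l.
  by case: l => // l _; rewrite /letters /w /= inordK // ltnS W_le.
have lt_w (i j : 'I_n) : s i < s j ->
    word_lt (iter i (@neg_shift _) w) (iter j (@neg_shift _) w).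
  move=> lt_ij; apply/neg_shift_lt.
  have [|||d lt_d] := order i.+1 j.+1; rewrite ?entry_one_line ?ltnS ?ltn_ord //.
  by exists d; apply: lt_at_eq lt_d => m _; rewrite /tail_from letters_w ?addSn.
have irr (v v' : word (size I).+1) : v =1 v' -> ~ word_lt v v'.
  by move=> e /word_lt_alt[d [_]]; rewrite e ltnn if_same.
exists w; split=> [i j neq_ij e|i j]; last first.
  split=> [lt|]; last exact: lt_w.
  case: (ltngtP (s i) (s j)) => // [lt_ji|e]; last first.
    have /perm_inj eij : s i = s j by apply: val_inj.
    by case: (irr _ _ _ lt) => m; rewrite eij.
  have /word_lt_alt := lt; move/alt_lt_asym; case; apply/word_lt_alt.
  exact: lt_w.
case: (ltngtP (s i) (s j)) => [/lt_w|/lt_w|]; [exact: irr | by apply: irr => m; rewrite e |].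
by move/val_inj/perm_inj => e'; rewrite e' eqxx in neq_ij.
Qed.

End Allowed.

(** * From words to valid segmentations *)

Lemma alt_lt_next W i j : W i = W j ->
  alt_lt (tail_from W i) (tail_from W j) ->
  alt_lt (tail_from W j.+1) (tail_from W i.+1).
Proof.
move=> eq_W lt_ij; have [|d lt_d] := alt_lt_tail _ lt_ij.
  by rewrite /tail_from !addn0.
by exists d; apply: lt_at_eq lt_d => m _; rewrite /tail_from add1n addSnnS.
Qed.

(** Here u = K 0 v: agreeing with v up to d, it starts as the largest word
    K 0 K 0 ... up to d. *)
Lemma zigzag_not_below K d u v : (forall i, v i <= K) ->
  u 0 = K -> u 1 = 0 -> (forall i, u i.+2 = v i) -> ~ lt_at d u v.
Proof.
move=> v_le u0 u1 u2 lt_d; apply: (max_word_maximal v_le _ lt_d).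
have {lt_d} [agree _] := lt_d.
suff main i : i <= d -> u i = max_word K i by apply: main.
elim/ltn_ind: i => -[|[|i]] IH le_id; [by rewrite u0 | by rewrite u1 |].
have -> : max_word K i.+2 = max_word K i by rewrite /max_word /= negbK.
by rewrite u2 -agree; [apply: IH; lia | lia].
Qed.

(** These are u, v = p u and w = p p u, with m the length of p. Where u leaves the
    word p p p ..., the two others still follow it, so u is on the same side of
    both. *)
Lemma square_same_side m u v w : 0 < m ->
  (forall i, v (m + i) = u i) ->
  (forall i, i < m -> w i = v i) -> (forall i, w (m + i) = v i) ->
  (alt_lt u v -> alt_lt u w) /\ (alt_lt v u -> alt_lt w u).
Proof.
move=> m_gt0 vu wv wv'.
have agree d : (forall i, i < d -> u i = v i) -> forall i, i <= d -> v i = w i.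
  move=> uv i le_id; have [/wv -> //|le_mi] := ltnP i m.
  by rewrite -(subnKC le_mi) wv' vu uv //; lia.
split=> -[d lt_d]; exists d; apply: lt_at_eq (lt_d) => // i; apply: agree => {}i.
  by case: lt_d => agree_d _ /agree_d.
by case: lt_d => agree_d _ /agree_d.
Qed.

Section Necessity.

Variables (pi : seq nat) (K : nat) (W : nat -> nat).
Hypothesis pi_perm : perm_eq pi (iota 1 (size pi)).

Local Notation n := (size pi).
Local Notation P := (entry pi).

Hypothesis n_ge3 : 3 <= n.
Hypothesis W_le : forall l, W l <= K.
Hypothesis order : forall i j, 0 < i <= n -> 0 < j <= n -> P i < P j ->
  alt_lt (tail_from W i) (tail_from W j).

Lemma order_inv i j : 0 < i <= n -> 0 < j <= n ->
  alt_lt (tail_from W i) (tail_from W j) -> P i < P j.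
Proof.
move=> i_in j_in lt_ij; case: (ltngtP (P i) (P j)) => // [lt_ji|eq_ij].
  by case: (alt_lt_asym lt_ij); apply: order.
by case: (alt_lt_asym lt_ij); rewrite (entry_injective pi_perm i_in j_in eq_ij) in lt_ij *.
Qed.

(** The value P n gets the letter of the next value, or the largest letter if
    P n = n. With its own letter it could be a cut. *)
Let past_star v := if v == P n then v.+1 else v.

Let value_letter v :=
  if past_star v <= n then W (position pi (past_star v)) else K.

Lemma value_letter_le v : value_letter v <= K.
Proof. by rewrite /value_letter; case: ifP. Qed.

Lemma value_letter_entry i : 0 < i < n -> value_letter (P i) = W i.
Proof.
move=> i_in; have past_i : past_star (P i) = P i.
  rewrite /past_star; case: eqP => // eq_P.
  by have := entry_injective pi_perm (i := i) (j := n) ltac:(lia) ltac:(lia) eq_P; lia.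
rewrite /value_letter past_i.
by have [_ ->] := andP (entry_bounds pi_perm (i := i) ltac:(lia)); rewrite entryK //; lia.
Qed.

Lemma value_letter_mono u v : 0 < u -> u <= v -> value_letter u <= value_letter v.
Proof.
move=> u_gt0 le_uv; rewrite /value_letter.
have [le_vn|] := leqP (past_star v) n; last by case: ifP.
have [eq_uv|lt_uv] : past_star u = past_star v \/ past_star u < past_star v.
  by rewrite /past_star; case: eqP; case: eqP; lia.
  by rewrite eq_uv le_vn.
rewrite ifT; last by lia.
have u_in : 0 < past_star u <= n by rewrite /past_star in lt_uv le_vn *; case: ifP lt_uv; lia.
have v_in : 0 < past_star v <= n by lia.
have := order (position_bounds pi_perm u_in) (position_bounds pi_perm v_in).
rewrite !positionK // => /(_ lt_uv) /alt_lt_head.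
by rewrite /tail_from !addn0.
Qed.

Let value_letters := [seq value_letter v | v <- iota 1 n].

Definition word_cuts := [seq count (fun a => a < t) value_letters | t <- iota 1 K].

Let I := word_cuts.
Let E := 0 :: rcons I n.

Lemma size_word_cuts : size I = K.
Proof. by rewrite size_map size_iota. Qed.

Lemma value_letters_sorted : sorted leq value_letters.
Proof.
apply/(sortedP 0) => i; rewrite size_map size_iota => lt_i.
by rewrite !(nth_map 0) ?size_iota ?nth_iota //; [apply: value_letter_mono | lia | lia]; lia.
Qed.

Lemma le_cut t v : 0 < v <= n -> t <= K.+1 -> (v <= nth 0 E t) = (value_letter v < t).
Proof.
move=> v_in; case: t => [|t] lt_t; first by rewrite /= leqNgt (andP v_in).1.
have [lt_tK|ge_tK] := ltnP t K.
  rewrite (nth_segmentation pi) ?size_word_cuts // /I /word_cuts (nth_map 0) ?size_iota // nth_iota //.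
  have := @nth_lt_count value_letters (1 + t) v.-1 value_letters_sorted.
  rewrite size_map size_iota => /(_ ltac:(lia)).
  rewrite (nth_map 0) ?size_iota ?nth_iota; [|lia|lia].
  have -> : 1 + v.-1 = v by lia.
  by rewrite add1n => ->; rewrite prednK //; lia.
have -> : t = K by lia.
rewrite -{1}size_word_cuts nth_segmentation_last ltnS value_letter_le.
by lia.
Qed.

Lemma cuts_bounded : all (fun e => e <= n) I.
Proof.
apply/allP=> e /mapP[t _ ->]; apply: leq_trans (count_size _ _) _.
by rewrite size_map size_iota.
Qed.

Lemma cuts_sorted : sorted leq I.
Proof.
apply/(sortedP 0) => i; rewrite size_word_cuts => lt_i.
rewrite !(nth_map 0) ?size_iota ?nth_iota //; [|lia|lia].
by apply: sub_count => a /=; lia.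
Qed.

Lemma star_bounds : 0 < P n <= n.
Proof. by apply: (entry_bounds pi_perm); lia. Qed.

Lemma star_not_cut : P n \notin I.
Proof.
apply/negP=> /(nthP 0)[t]; rewrite size_word_cuts => lt_t e_t.
have cut v := @le_cut t.+1 v; rewrite (nth_segmentation pi) ?size_word_cuts // e_t in cut.
have := cut (P n) star_bounds ltac:(lia); rewrite leqnn => /esym.
have past_star_star : past_star (P n) = (P n).+1 by rewrite /past_star eqxx.
have past_star_next : past_star (P n).+1 = (P n).+1 by rewrite /past_star; case: eqP; lia.
have [le_n|lt_n] := ltnP (P n) n; last by rewrite /value_letter past_star_star ifF; lia.
have := cut (P n).+1 ltac:(lia) ltac:(lia).
by rewrite ltnn /value_letter past_star_star past_star_next => <-.
Qed.

Lemma cuts_decreasing :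
  all (fun t => decreasing_block pi (nth 0 E t) (nth 0 E t.+1)) (iota 0 (size I).+1).
Proof.
apply/allP=> t; rewrite mem_iota size_word_cuts => t_in.
apply/(decreasing_blockP pi_perm _ (segmentation_le cuts_bounded _)).
move=> i j i_in j_in lt_ti lt_ij le_jt.
have Pi_in := entry_bounds pi_perm (i := i) ltac:(lia).
have Pj_in := entry_bounds pi_perm (i := j) ltac:(lia).
have := value_letter_mono (andP Pi_in).1 (ltnW lt_ij).
move: lt_ti le_jt; rewrite ltnNge (le_cut Pi_in) ?(le_cut Pj_in); [|lia|lia].
rewrite (value_letter_entry i_in) (value_letter_entry j_in) => ge_i lt_j le_ij.
apply: order_inv; [lia | lia | apply: alt_lt_next; first lia].
by apply: order; lia.
Qed.

(** If both alternatives failed, the letters of w at positions n - 2 and n - 1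
    would be K and 0, or 0 and K. In the first case u_(n-2) = K 0 u_n could not be
    below u_n; the second one is its complement. *)
Lemma cuts_corner : corner_condition pi I.
Proof.
have tail_le i m : tail_from W i m <= K by apply: W_le.
have tail2 i : tail_from W (n - 2) i.+2 = tail_from W n i.
  by rewrite /tail_from; congr W; lia.
have head_cut : nth 0 E 1 = head n I by rewrite /E /=; case: (I).
have last_cut : nth 0 E K = last 0 I by rewrite /E -size_word_cuts nth_rcons_last.
have last_star : last 0 I = P n -> last 0 I = 0.
  move=> e; move: star_not_cut; rewrite -e.
  by case: (I) => //= a J; rewrite mem_last.
have head_star : head n I = P n -> I = [::].
  by move=> e; move: star_not_cut; rewrite -e; case: (I) => //= a J; rewrite mem_head.
apply/andP; split; apply/implyP=> /and4P[_ /eqP P2 /eqP P1 /eqP Pn].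
  rewrite -head_cut -last_cut; apply: contraT; rewrite negb_or => /andP[head_n0 last_n].
  have L1 := @le_cut 1 1 ltac:(lia) ltac:(lia).
  have Ln := @le_cut K n.-1 ltac:(lia) ltac:(lia).
  have vl1 := value_letter_entry (i := n - 1) ltac:(lia).
  have vl2 := value_letter_entry (i := n - 2) ltac:(lia).
  rewrite P1 in vl1; rewrite P2 in vl2; rewrite vl1 in L1; rewrite vl2 in Ln.
  have le_last : nth 0 E K <= n := segmentation_le cuts_bounded K.
  have W1 : W (n - 1) = 0 by lia.
  have W2 : W (n - 2) = K.
    by have := W_le (n - 2); rewrite last_cut in last_n le_last Ln; lia.
  have [d] : alt_lt (tail_from W (n - 2)) (tail_from W n) by apply: order; lia.
  move=> lt_d; case: (zigzag_not_below (K := K) _ _ _ _ lt_d) => //.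
    by rewrite /tail_from addn0.
  rewrite /tail_from; have -> : n - 2 + 1 = n - 1 by lia.
  by [].
rewrite -last_cut; apply: contraT; rewrite negb_or => /andP[head_n0 last_n].
have L1 := @le_cut 1 2 ltac:(lia) ltac:(lia).
have Ln := @le_cut K n ltac:(lia) ltac:(lia).
have vl1 := value_letter_entry (i := n - 1) ltac:(lia).
have vl2 := value_letter_entry (i := n - 2) ltac:(lia).
rewrite P1 in vl1; rewrite P2 in vl2; rewrite vl2 in L1; rewrite vl1 in Ln.
have le_last : nth 0 E K <= n := segmentation_le cuts_bounded K.
have head_ge2 : 2 <= head n I.
  have : head n I <> 1 \/ I = [::] by case: (head n I =P 1) => [e|]; [right; apply: head_star; lia | left].
  by case=> [|->] /=; lia.
rewrite head_cut in L1.
have W2 : W (n - 2) = 0 by lia.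
have W1 : W (n - 1) = K by have := W_le (n - 1); lia.
have [d] : alt_lt (tail_from W n) (tail_from W (n - 2)) by apply: order; lia.
move/(lt_at_complement (tail_le n) (tail_le (n - 2))) => lt_d.
case: (zigzag_not_below (K := K) _ _ _ _ lt_d); rewrite /tail_from.
- by move=> i; apply: leq_subr.
- by rewrite addn0 W2 subn0.
- have -> : n - 2 + 1 = n - 1 by lia.
  by rewrite W1 subnn.
- by move=> i; rewrite -[W (n - 2 + i.+2)]/(tail_from W (n - 2) i.+2) tail2.
Qed.

Lemma prefix_letter_cuts i : 0 < i < n -> prefix_letter pi E i = W i.
Proof.
move=> i_in.
have [] := prefix_letterP pi_perm cuts_sorted cuts_bounded (i := i) ltac:(lia).
rewrite -/E size_word_cuts; move: (prefix_letter pi E i) => t le_t.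
have Pi_in := entry_bounds pi_perm (i := i) ltac:(lia).
rewrite ltnNge !(le_cut Pi_in); [|lia|lia].
by rewrite value_letter_entry //; lia.
Qed.

Lemma word_cuts_valid : valid_neg_segmentation pi K.+1 (0 :: rcons word_cuts n).
Proof.
rewrite -/I -/E; apply/andP; split.
  rewrite -size_word_cuts neg_segmentationE // cuts_sorted cuts_bounded star_not_cut cuts_corner.
  by rewrite -(decreasing_blocks_ascents pi_perm cuts_sorted cuts_bounded star_not_cut) cuts_decreasing.
apply/negP=> /and3P[n1 nn]; have star_in := star_bounds.
have x_in := position_bounds pi_perm (v := (P n).+1) ltac:(lia).
have Px := positionK pi_perm (v := (P n).+1) ltac:(lia).
have y_in := position_bounds pi_perm (v := (P n).-1) ltac:(lia).
have Py := positionK pi_perm (v := (P n).-1) ltac:(lia).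
rewrite /prefix_tail /xpos /ypos.
move: (position pi (P n).+1) (position pi (P n).-1) x_in y_in Px Py => x y x_in y_in Px Py.
have xn : x <> n by move=> e; rewrite e in Px; lia.
have yn : y <> n by move=> e; rewrite e in Py; lia.
have square a b : 0 < a < n -> 0 < b < n -> n - a = (n - b).*2 ->
    (forall i, i < n - b -> prefix_letter pi E (a + i) = prefix_letter pi E (b + i)) ->
    (P n < P b -> P n < P a) /\ (P b < P n -> P a < P n).
  move=> a_in b_in eq_len eq_z.
  have tail_b i : tail_from W b (n - b + i) = tail_from W n i.
    by rewrite /tail_from; congr W; lia.
  have tail_a i : tail_from W a (n - b + i) = tail_from W b i.
    by rewrite /tail_from; congr W; lia.
  have head_a i : i < n - b -> tail_from W a i = tail_from W b i.
    by move=> lt_i; rewrite /tail_from -!prefix_letter_cuts; [exact: eq_z | lia | lia].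
  have [up dn] := square_same_side (m := n - b) ltac:(lia) tail_b head_a tail_a.
  have le_0n a' : 0 < a' < n -> 0 < a' <= n by case/andP=> -> /ltnW ->.
  have n_in : 0 < n <= n by rewrite leqnn andbT; lia.
  have [a_in' b_in'] := (le_0n a a_in, le_0n b b_in).
  split=> lt.
    by apply: (order_inv n_in a_in'); apply: up; apply: order.
  by apply: (order_inv a_in' n_in); apply: dn; apply: order.
have x_lt : 0 < x < n by lia.
have y_lt : 0 < y < n by lia.
have [x_le y_le] := ((andP x_in).2, (andP y_in).2).
case/orP=> [/(squareP _ x_le y_le)|/(squareP _ y_le x_le)] [eq_len eq_z].
  by have [_] := square x y x_lt y_lt eq_len eq_z; rewrite Px Py; lia.
by have [+ _] := square y x y_lt x_lt eq_len eq_z; rewrite Px Py; lia.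
Qed.

End Necessity.

Theorem allowed_valid_segmentation n k (s : 'S_n) : 3 <= n -> 0 < k ->
  allow_neg_shift k s -> exists E, valid_neg_segmentation (one_line s) k E.
Proof.
move=> n_ge3; case: k => // K _ [w [_ order]].
have szn := size_one_line s.
exists (0 :: rcons (word_cuts (one_line s) K (letters w)) (size (one_line s))).
apply: (word_cuts_valid (one_line_perm s)); rewrite ?szn //.
  by move=> l; rewrite /letters -ltnS ltn_ord.
case=> // i [|j] //= lt_i lt_j.
rewrite (entry_one_line s (Ordinal lt_i)) (entry_one_line s (Ordinal lt_j)) ltnS.
by move/order/neg_shift_lt.
Qed.

(** * Counting the smallest valid segmentations *)

Lemma perm_extra (T : eqType) (s t : seq T) :
  uniq s -> {subset s <= t} -> size t = (size s).+1 ->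
  exists m, perm_eq t (m :: s).
Proof.
elim: s t => [|a s IH] t; first by case: t => [|m []] // _ _ _; exists m.
move=> /= /andP[a_notin uniq_s] sub size_t.
have a_in : a \in t by apply: sub; rewrite mem_head.
have [|||m perm_m] := IH (rem a t) => //.
- move=> b b_in; have := sub b; rewrite inE b_in orbT => /(_ isT).
  by rewrite (perm_mem (perm_to_rem a_in)) inE => /predU1P[eb|//]; rewrite -eb b_in in a_notin.
- by rewrite size_rem // size_t.
exists m; apply: perm_trans (perm_to_rem a_in) _.
by rewrite perm_sym (perm_catCA [:: m] [:: a] s) /= perm_cons perm_sym.
Qed.

Lemma head_sorted_eq0 d s : 0 < d -> sorted leq s -> (head d s == 0) = (0 \in s).
Proof.
case: s => [|a s] //= d_gt0; first by rewrite eqn0Ngt d_gt0.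
move=> /(order_path_min leq_trans) /allP min_a; rewrite inE eq_sym.
by case: eqP => //= a_neq0; apply/esym/negbTE/negP => /min_a; lia.
Qed.

Lemma last_sorted_eq b s : 0 < b -> all (fun e => e <= b) s -> sorted leq s ->
  (last 0 s == b) = (b \in s).
Proof.
case/lastP: s => [|s c] b_gt0; first by rewrite eq_sym eqn0Ngt b_gt0.
rewrite all_rcons last_rcons => /andP[le_cb _] sorted_s.
rewrite mem_rcons inE eq_sym; case: eqP => //= neq_bc.
apply/esym/negbTE/negP => b_in.
have lt_b : index b s < size s by rewrite index_mem.
have le_bc : b <= c.
  have := sorted_leq_nth leq_trans leqnn 0 sorted_s (index b s) (size s).
  by rewrite !inE size_rcons !nth_rcons lt_b ltnn eqxx nth_index //; apply; lia.
lia.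
Qed.

Section Counting.

Variable pi : seq nat.
Hypothesis pi_perm : perm_eq pi (iota 1 (size pi)).

Local Notation n := (size pi).
Local Notation P := (entry pi).
Local Notation A := (ascents pi).

Hypothesis n_ge3 : 3 <= n.

Lemma count_valid k Es : uniq Es ->
  (forall E, valid_neg_segmentation pi k E = (E \in Es)) ->
  num_valid_neg_segmentations pi k = size Es.
Proof.
move=> uniq_Es validE; rewrite /num_valid_neg_segmentations cardE.
set S := [set _ | _].
pose f (E : (k.+1).-tuple 'I_n.+1) := [seq val e | e <- E].
have f_inj : injective f by move=> E E' /(inj_map val_inj)/val_inj.
rewrite -(size_map f); apply/perm_size/uniq_perm => //.
  by rewrite map_inj_uniq ?enum_uniq.
move=> E; rewrite -validE; apply/mapP/idP => [[E' + ->]|valid_E].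
  by rewrite mem_enum inE.
have /andP[seg _] := valid_E.
have [I ek eE] := neg_segmentation_shape (ltnW (ltnW n_ge3)) seg.
have size_E : size [seq inord e : 'I_n.+1 | e <- E] == k.+1.
  by rewrite size_map eE ek /= size_rcons.
have mapK : [seq val e | e <- [seq inord e : 'I_n.+1 | e <- E]] = E.
  rewrite -map_comp -[RHS]map_id; apply/eq_in_map => e e_in /=; rewrite inordK // ltnS.
  have I_le : all (fun e => e <= n) I.
    by move: seg; rewrite ek eE neg_segmentationE // => /and5P[].
  by move: e_in; rewrite eE inE mem_rcons inE => /or3P[/eqP ->|/eqP ->|/(allP I_le)].
by exists (Tuple size_E); rewrite ?mem_enum ?inE /f /= mapK.
Qed.

Lemma mem_ascents j : j \in A -> 0 < j < n.
Proof. by rewrite mem_filter mem_iota; lia. Qed.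

Lemma ascents_ltn_sorted : sorted ltn A.
Proof. by apply: sorted_filter; [exact: ltn_trans | exact: iota_ltn_sorted]. Qed.

Lemma ascents_sorted : sorted leq A.
Proof. by apply: sub_sorted ascents_ltn_sorted => a b /ltnW. Qed.

Lemma ascents_uniq : uniq A.
Proof. by rewrite filter_uniq ?iota_uniq. Qed.

Lemma ascents_le : all (fun e => e <= n) A.
Proof. by apply/allP=> j /mem_ascents; lia. Qed.

Lemma star_not_ascent : P n \notin A.
Proof.
rewrite mem_filter /ascent hat_star_entry ?ltnn //; lia.
Qed.

Lemma segmentation_min_size k E : neg_segmentation pi k E -> asc pi < k.
Proof.
move=> seg; have [I ek eE] := neg_segmentation_shape (ltnW (ltnW n_ge3)) seg.
move: seg; rewrite ek eE neg_segmentationE // => /and5P[_ _ _ /allP sub _].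
by rewrite ltnS; apply: uniq_leq_size ascents_uniq sub.
Qed.

Lemma minimal_segmentation_unique E :
  neg_segmentation pi (asc pi).+1 E -> E = minimal_sequence pi.
Proof.
move=> seg; have [I [ek] eE] := neg_segmentation_shape (ltnW (ltnW n_ge3)) seg.
move: seg; rewrite ek eE neg_segmentationE // => /and5P[sorted_I _ _ /allP sub _].
have le_size : size I <= size A by rewrite -ek.
have [_ eq_mem] := uniq_min_size ascents_uniq sub le_size.
have uniq_I := leq_size_uniq ascents_uniq sub le_size.
rewrite /minimal_sequence; congr (0 :: rcons _ n).
apply: (sorted_eq leq_trans anti_leq) => //; first exact: ascents_sorted.
by apply: (uniq_perm uniq_I ascents_uniq) => // j; rewrite eq_mem.
Qed.

Lemma corner1_ascents : ends_with pi n.-1 1 n -> n.-1 \notin A.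
Proof.
case/and4P=> _ /eqP P2 _ /eqP Pn; rewrite mem_filter negb_and /ascent.
have hat_pred := hat_star_entry pi_perm (i := n - 2) ltac:(lia).
have hat_last := hat_star_entry pi_perm (i := n) ltac:(lia).
rewrite P2 ifT in hat_pred; last lia.
rewrite Pn ltnn in hat_last.
have -> : n.-1.+1 = n by lia.
by rewrite hat_pred hat_last ltnn.
Qed.

(** Neither of the alternatives can be met by an ascent: ascents are positive and
    smaller than n, and n - 1 is not an ascent when the star is at n. *)
Lemma corner_ascents : cornered pi -> ~~ corner_condition pi A.
Proof.
have zero_notin : 0 \notin A by apply/negP => /mem_ascents.
have n_notin : n \notin A by apply/negP => /mem_ascents; lia.
have n_gt0 : 0 < n by lia.
have head_A : (head n A == 0) = false.
  by rewrite (head_sorted_eq0 n_gt0 ascents_sorted) (negbTE zero_notin).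
have last_A : (last 0 A == n) = false.
  by rewrite (last_sorted_eq n_gt0 ascents_le ascents_sorted) (negbTE n_notin).
rewrite /corner_condition head_A last_A /= implybF => /orP[corner|->]; last by rewrite andbF.
have le_A : all (fun e => e <= n.-1) A by apply/allP=> j /mem_ascents; lia.
rewrite corner /= last_sorted_eq ?ascents_sorted //; last by lia.
by rewrite (negbTE (corner1_ascents corner)).
Qed.

Lemma cornered_no_minimal : cornered pi ->
  ~~ neg_segmentation pi (asc pi).+1 (minimal_sequence pi).
Proof.
by move=> /corner_ascents/negbTE corner; rewrite neg_segmentationE // corner !andbF.
Qed.

Lemma minimal_segmentation : ~~ cornered pi ->
  neg_segmentation pi (asc pi).+1 (minimal_sequence pi).
Proof.
rewrite negb_or => /andP[/negbTE c1 /negbTE c2].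
rewrite neg_segmentationE // ascents_sorted ascents_le star_not_ascent /corner_condition c1 c2.
by rewrite /= andbT; apply/allP.
Qed.

Lemma regular_segmentations : regular pi ->
  forall E, valid_neg_segmentation pi (asc pi).+1 E = (E \in [:: minimal_sequence pi]).
Proof.
case/andP=> not_corner not_collapsed E; rewrite inE.
apply/andP/eqP => [[/minimal_segmentation_unique //]|->].
have seg := minimal_segmentation not_corner; split=> //.
by move: not_collapsed; rewrite /collapsed /minimal_neg_segmentation eqxx add1n seg.
Qed.

Definition with_extra_cut m := sort leq (m :: A).
Definition refined m := 0 :: rcons (with_extra_cut m) n.

Lemma with_extra_cut_sorted m : sorted leq (with_extra_cut m).
Proof. by apply: sort_sorted; apply: leq_total. Qed.

Lemma mem_with_extra_cut m j : (j \in with_extra_cut m) = (j == m) || (j \in A).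
Proof. by rewrite mem_sort inE. Qed.

Lemma with_extra_cut_le m b : 0 < b -> m <= b -> {in A, forall j, j <= b} ->
  all (fun e => e <= b) (with_extra_cut m).
Proof.
by move=> b_gt0 le_m le_A; apply/allP=> j; rewrite mem_with_extra_cut => /predU1P[->|/le_A].
Qed.

Lemma refined_injective : injective refined.
Proof.
move=> m m' [/rcons_inj[eq_cut]].
have : perm_eq ([:: m] ++ A) ([:: m'] ++ A).
  exact/(perm_sortP leq_total leq_trans anti_leq).
by rewrite perm_cat2r => /perm_mem/(_ m); rewrite !inE eqxx => /esym/eqP.
Qed.

Lemma refined_segmentation m : neg_segmentation pi (asc pi).+2 (refined m) =
  [&& m <= n, m != P n & corner_condition pi (with_extra_cut m)].
Proof.
have -> : (asc pi).+2 = (size (with_extra_cut m)).+1 by rewrite size_sort.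
rewrite neg_segmentationE // with_extra_cut_sorted mem_with_extra_cut negb_or star_not_ascent.
have -> : all (mem (with_extra_cut m)) A.
  by apply/allP=> j j_in; rewrite /= mem_with_extra_cut j_in orbT.
rewrite all_sort /= ascents_le !andbT /= [P n == m]eq_sym.
by [].
Qed.

Lemma segmentation_refined E : neg_segmentation pi (asc pi).+2 E ->
  exists m, E = refined m.
Proof.
move=> seg; have [I [ek] eE] := neg_segmentation_shape (ltnW (ltnW n_ge3)) seg.
move: seg; rewrite ek eE neg_segmentationE // => /and5P[sorted_I _ _ /allP sub _].
have [m perm_m] := perm_extra ascents_uniq sub (esym ek).
exists m; congr (0 :: rcons _ n).
apply: (sorted_eq leq_trans anti_leq) => //; first exact: with_extra_cut_sorted.
by rewrite perm_sym perm_sort perm_sym.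
Qed.

(** The corner condition asks for a cut at 0, or at b = n - 1 (if P n = n) or b = n
    (if P n = 1), and no ascent provides one. *)
Lemma cornered_segmentations : cornered pi ->
  exists2 b, 0 < b & forall E, valid_neg_segmentation pi (asc pi).+2 E =
    (E \in [:: refined 0; refined b]).
Proof.
move=> corner.
have not_invalid E : invalid pi E = false.
  by rewrite /invalid; case/orP: corner => /and4P[_ _ _ ->]; rewrite /= ?andbF.
have valid_refined b : 0 < b -> (forall m, neg_segmentation pi (asc pi).+2 (refined m) =
      (m == 0) || (m == b)) ->
    forall E, valid_neg_segmentation pi (asc pi).+2 E = (E \in [:: refined 0; refined b]).
  move=> b_gt0 segE E; rewrite /valid_neg_segmentation not_invalid andbT !inE.
  apply/idP/orP => [seg|[]/eqP ->]; rewrite ?segE ?eqxx ?orbT //.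
  have [m em] := segmentation_refined seg; subst E.
  by move: seg; rewrite segE => /orP[] /eqP ->; rewrite eqxx; [left|right].
have zero_notin : 0 \in A = false by apply/negbTE/negP => /mem_ascents.
have [corner1|not_corner1] := boolP (ends_with pi n.-1 1 n).
  exists n.-1; first lia.
  apply: valid_refined => [|m]; first lia.
  have Pn : P n = n by case/and4P: corner1 => _ _ _ /eqP.
  have P1 : P (n - 1) = 1 by case/and4P: corner1 => _ _ /eqP.
  have corner2 : ends_with pi 2 n 1 = false by rewrite /ends_with Pn P1; lia.
  have notin := corner1_ascents corner1.
  rewrite refined_segmentation /corner_condition corner1 corner2 /= andbT Pn.
  rewrite head_sorted_eq0 ?mem_with_extra_cut ?zero_notin ?orbF ?with_extra_cut_sorted //; last lia.
  have [m_lt|] := boolP (m < n); last by move=> ge_m; lia.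
  rewrite last_sorted_eq ?mem_with_extra_cut ?(negbTE notin) ?with_extra_cut_sorted //; last 2 first.
  - lia.
  - by apply: with_extra_cut_le => [||j /mem_ascents]; lia.
  lia.
exists n; first lia.
have corner2 : ends_with pi 2 n 1 by move: corner; rewrite /cornered (negbTE not_corner1).
apply: valid_refined => [|m]; first lia.
have Pn : P n = 1 by case/and4P: corner2 => _ _ _ /eqP.
have n_notin : n \in A = false by apply/negbTE/negP => /mem_ascents; lia.
rewrite refined_segmentation /corner_condition (negbTE not_corner1) corner2 /= Pn.
rewrite head_sorted_eq0 ?mem_with_extra_cut ?zero_notin ?orbF ?with_extra_cut_sorted //; last lia.
have [m_le|] := boolP (m <= n); last by move=> ge_m; lia.
rewrite last_sorted_eq ?mem_with_extra_cut ?n_notin ?with_extra_cut_sorted //; last 2 first.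
- lia.
- by apply: with_extra_cut_le => [||j /mem_ascents]; lia.
lia.
Qed.

Section Collapsed.

Hypothesis collapsed_pi : collapsed pi.

Local Notation z := (prefix_letter pi (minimal_sequence pi)).

Lemma star_inner : 1 < P n < n.
Proof. by have := star_bounds pi_perm n_ge3; case/andP: collapsed_pi => _ /and3P[n1 nn _]; lia. Qed.

Lemma collapsed_minimal_segmentation : neg_segmentation pi (size A).+1 (minimal_sequence pi).
Proof. by case/andP: collapsed_pi => /andP[_]. Qed.

Lemma collapsed_not_cornered : ~~ cornered pi.
Proof. by apply/negP=> /cornered_no_minimal; rewrite collapsed_minimal_segmentation. Qed.

Lemma minimal_labelling : labelling n P z (size A).
Proof. exact: segmentation_labelling collapsed_minimal_segmentation. Qed.

(** The tail from a is the square of the tail from b. An extra cut does not change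
    the lengths, so it preserves or destroys this equality and cannot create the
    opposite one. *)
Lemma collapsed_square : exists a b, [/\ 0 < a < n /\ 0 < b < n, n - a = (n - b).*2,
   (P a = (P n).+1 /\ (P b).+1 = P n) \/ ((P a).+1 = P n /\ P b = (P n).+1),
   minn (n - xpos pi) (n - ypos pi) = n - b &
   (forall i, i < n - b -> z (a + i) = z (b + i)) /\
   forall m, invalid pi (refined m) = all (fun i =>
     prefix_letter pi (refined m) (a + i) == prefix_letter pi (refined m) (b + i))
     (iota 0 (n - b))].
Proof.
have star_in := star_inner.
have x_in := position_bounds pi_perm (v := (P n).+1) ltac:(lia).
have Px := positionK pi_perm (v := (P n).+1) ltac:(lia).
have y_in := position_bounds pi_perm (v := (P n).-1) ltac:(lia).
have Py := positionK pi_perm (v := (P n).-1) ltac:(lia).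
case/andP: collapsed_pi => _ /and3P[n1 nn].
rewrite /invalid n1 nn /= /prefix_tail /xpos /ypos.
move: (position pi (P n).+1) (position pi (P n).-1) x_in y_in Px Py => x y x_in y_in Px Py.
have xn : x <> n by move=> e; rewrite e in Px; lia.
have yn : y <> n by move=> e; rewrite e in Py; lia.
have [x_le y_le] := ((andP x_in).2, (andP y_in).2).
have x_lt : 0 < x < n by lia.
have y_lt : 0 < y < n by lia.
have oneway (w : nat -> nat) a b (a_le : a <= n) (b_le : b <= n) : n - a = (n - b).*2 -> b < n ->
    let tail i := [seq w l | l <- iota i (n - i)] in
    (tail a == tail b ++ tail b) = all (fun i => w (a + i) == w (b + i)) (iota 0 (n - b)) /\
    (tail b == tail a ++ tail a) = false.
  move=> eq_len b_lt tail; split.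
    apply/(squareP w a_le b_le)/allP => [[_ eq_w] i|eq_w].
      by rewrite mem_iota => /andP[_ lt_i]; apply/eqP/eq_w.
    by split=> // i lt_i; apply/eqP/eq_w; rewrite mem_iota.
  by apply/(squareP w b_le a_le) => -[eq_len' _]; lia.
case/orP=> [/(squareP _ x_le y_le)|/(squareP _ y_le x_le)] [eq_len eq_z].
  exists x, y; split=> //; [by left; split=> //; lia | lia | split=> // m].
  by have [-> ->] := oneway (prefix_letter pi (refined m)) x y x_le y_le eq_len ltac:(lia);
     rewrite orbF.
exists y, x; split=> //; [by right; split=> //; lia | lia | split=> // m].
by have [-> ->] := oneway (prefix_letter pi (refined m)) y x y_le x_le eq_len ltac:(lia).
Qed.

Lemma refined_letter m i : m <= n -> 0 < i <= n ->
  prefix_letter pi (refined m) i = (m < P i) + z i.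
Proof.
move=> m_le i_in.
have cut_le : all (fun e => e <= n) (with_extra_cut m).
  by apply: with_extra_cut_le => // [|j /mem_ascents]; lia.
rewrite (prefix_letter_count pi_perm (with_extra_cut_sorted m) cut_le i_in).
rewrite (prefix_letter_count pi_perm ascents_sorted ascents_le i_in).
by rewrite /with_extra_cut count_sort.
Qed.

(** Downward induction on i. A value strictly between the two carries the same
    letter, so the entry after it lies strictly between the entries of the next
    pair, or between P b and P n for the last one. The value P n itself has no
    entry after it; but if it lies between the values of a pair with i > 0, so
    does P n - 1 or P n + 1, as these two values belong to the pair with i = 0. *)
Lemma adjacent_pairs a b i : 0 < a < n -> 0 < b < n -> n - a = (n - b).*2 ->
  (P a = (P n).+1 /\ (P b).+1 = P n) \/ ((P a).+1 = P n /\ P b = (P n).+1) ->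
  (forall i, i < n - b -> z (a + i) = z (b + i)) -> 0 < i < n - b ->
  P (a + i) = (P (b + i)).+1 \/ P (b + i) = (P (a + i)).+1.
Proof.
move=> a_in b_in eq_len near eq_z.
have inj := entry_injective pi_perm.
have rg := entry_bounds pi_perm.
have [r] := ubnPeq (n - b - i); elim: r i => [|r IH] i; first lia.
move=> er i_in.
have next : P (a + i).+1 = (P (b + i).+1).+1 \/ P (b + i).+1 = (P (a + i).+1).+1.
  have [ei|ni] := eqVneq i.+1 (n - b).
    have -> : (a + i).+1 = b by lia.
    have -> : (b + i).+1 = n by lia.
    lia.
  by rewrite -!addnS; apply: IH; lia.
have close u v : 0 < u < n -> 0 < v < n -> z u = z v -> P u < P v ->
    u <> a -> u <> b -> P u.+1 <= (P v.+1).+1 -> P v = (P u).+1.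
  move=> u_in v_in eq_uv lt_uv ua ub small.
  have [//|gap] := eqVneq (P v) (P u).+1.
  have [c c_in /andP[lt_uc lt_cv]] : exists2 c, 0 < c < n & P u < P c < P v.
    have Pv := rg v ltac:(lia).
    have [c c_in Pc] := entry_surjective pi_perm (v := (P u).+1) ltac:(lia).
    have [cn|cn] := eqVneq c n; last by exists c; lia.
    have [c' c'_in Pc'] := entry_surjective pi_perm (v := (P u).+2) ltac:(lia).
    have c'n : c' <> n by move=> e; rewrite e -cn in Pc'; lia.
    have nua : P u <> P a by move=> e; apply: ua; apply: inj e; lia.
    have nub : P u <> P b by move=> e; apply: ub; apply: inj e; lia.
    by rewrite cn in Pc; lia.
  have le1 := letter_mono minimal_labelling u_in c_in lt_uc.
  have le2 := letter_mono minimal_labelling c_in v_in lt_cv.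
  have lt1 := letter_anti minimal_labelling u_in c_in lt_uc ltac:(lia).
  have lt2 := letter_anti minimal_labelling c_in v_in lt_cv ltac:(lia).
  lia.
have neq : P (a + i) <> P (b + i) by move=> e; have := inj _ _ _ _ e; lia.
have eq_zi := eq_z i ltac:(lia).
have [lt|lt] : P (a + i) < P (b + i) \/ P (b + i) < P (a + i) by lia.
  by right; apply: close; lia.
by left; apply: close; lia.
Qed.

(** An extra cut restores validity when it separates the values of a pair. There is
    one such cut for each pair, just after its lower value: for i > 0 the values are
    adjacent, and for i = 0 they are P n - 1 and P n + 1, but the cut P n is
    excluded. *)
Lemma collapsed_segmentations : exists Es,
  [/\ uniq Es, size Es = minn (n - xpos pi) (n - ypos pi), 0 < size Es &
      forall E, valid_neg_segmentation pi (asc pi).+2 E = (E \in Es)].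
Proof.
have [a [b [[a_in b_in] eq_len near -> [eq_z invalidE]]]] := collapsed_square.
have inj := entry_injective pi_perm.
have rg := entry_bounds pi_perm.
pose low i := minn (P (a + i)) (P (b + i)).
have adj i := @adjacent_pairs a b i a_in b_in eq_len near eq_z.
have valid_refined m : valid_neg_segmentation pi (asc pi).+2 (refined m) =
    (m \in [seq low i | i <- iota 0 (n - b)]).
  rewrite /valid_neg_segmentation refined_segmentation.
  have -> : corner_condition pi (with_extra_cut m).
    by move: collapsed_not_cornered; rewrite negb_or /corner_condition => /andP[/negbTE -> /negbTE ->].
  rewrite andbT invalidE -has_predC.
  apply/andP/mapP => [[/andP[m_le m_star] /hasP[i]]|[i]].
    rewrite mem_iota => /andP[_ lt_i] /=; rewrite !refined_letter //; [|lia|lia].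
    rewrite eq_z // eqn_add2r => sep; exists i; first by rewrite mem_iota.
    have [i0|i_gt0] := posnP i; last by have := adj i ltac:(lia); rewrite /low; lia.
    by subst i; rewrite /low !addn0 in sep *; lia.
  rewrite mem_iota => /andP[_ lt_i] em.
  have Pa := rg (a + i) ltac:(lia); have Pb := rg (b + i) ltac:(lia).
  have neq_ab : P (a + i) <> P (b + i) by move=> e; have := inj _ _ _ _ e; lia.
  have neq_a : P (a + i) <> P n by move=> e; have := inj _ _ _ _ e; lia.
  have neq_b : P (b + i) <> P n by move=> e; have := inj _ _ _ _ e; lia.
  rewrite /low in em; split; first by lia.
  apply/hasP; exists i; first by rewrite mem_iota.
  rewrite /= !refined_letter; [|lia|lia|lia|lia].
  by rewrite eq_z // eqn_add2r; lia.
exists [seq refined (low i) | i <- iota 0 (n - b)]; split.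
- rewrite map_inj_in_uniq ?iota_uniq // => i j; rewrite !mem_iota => i_in j_in.
  move/refined_injective; rewrite /low => e.
  have [i1 i2 i3 i4] : [/\ P (a + i) = P (a + j) -> i = j, P (b + i) = P (b + j) -> i = j,
     P (a + i) <> P (b + j) & P (b + i) <> P (a + j)].
    by split=> e'; have := inj _ _ _ _ e'; lia.
  lia.
- by rewrite size_map size_iota.
- by rewrite size_map size_iota; lia.
move=> E; rewrite (map_comp refined low).
apply/idP/mapP => [valid_E|[m m_in ->]]; last by rewrite valid_refined.
have [m em] := segmentation_refined (andP valid_E).1.
by exists m; rewrite // -valid_refined -em.
Qed.

End Collapsed.

End Counting.

Theorem theorem5p3 (n : nat) (n_ge3 : 3 <= n) (s : 'S_n) :
  let pi := one_line s in
  exists N : nat,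
    [/\ is_Nbar s N,
        N = 1 + asc pi + epsilon_bar pi,
        regular pi -> num_valid_neg_segmentations pi N = 1,
        cornered pi -> num_valid_neg_segmentations pi N = 2
      & collapsed pi ->
          num_valid_neg_segmentations pi N = minn (n - xpos pi) (n - ypos pi)].
Proof.
move=> pi; exists (1 + asc pi + epsilon_bar pi).
have pi_perm : perm_eq pi (iota 1 (size pi)) := one_line_perm s.
have size_pi : size pi = n := size_one_line s.
have size_ge3 : 3 <= size pi by rewrite size_pi.
have count := count_valid pi_perm size_ge3.
have regN : regular pi -> 1 + asc pi + epsilon_bar pi = (asc pi).+1.
  by rewrite /regular /epsilon_bar => /andP[/negbTE -> /negbTE ->]; rewrite addn0.
have irregN : cornered pi || collapsed pi -> 1 + asc pi + epsilon_bar pi = (asc pi).+2.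
  by rewrite /epsilon_bar => ->; rewrite addn1.
have not_regular : ~~ regular pi -> cornered pi || collapsed pi.
  by rewrite /regular negb_and !negbK.
have min_E := minimal_segmentation_unique pi_perm size_ge3.
have N_min k : 0 < k -> allow_neg_shift k s -> 1 + asc pi + epsilon_bar pi <= k.
  move=> k_gt0 /(allowed_valid_segmentation n_ge3 k_gt0)[E /andP[seg valid]].
  have lt_k := segmentation_min_size pi_perm size_ge3 seg.
  have [reg|/not_regular irreg] := boolP (regular pi); first by rewrite regN.
  rewrite irregN // ltn_neqAle lt_k andbT; apply/eqP=> ek.
  rewrite -ek in seg; have eE := min_E _ seg; subst E.
  case/orP: irreg => [corner|/andP[_ inv]]; last by rewrite inv in valid.
  by have := cornered_no_minimal pi_perm size_ge3 corner; rewrite seg.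
have [Es [uniq_Es Es_gt0 validE]] : exists Es, [/\ uniq Es, 0 < size Es &
    forall E, valid_neg_segmentation pi (1 + asc pi + epsilon_bar pi) E = (E \in Es)].
  have [reg|/not_regular irreg] := boolP (regular pi).
    by exists [:: minimal_sequence pi]; split=> // E; rewrite regN // regular_segmentations.
  rewrite irregN //; case/orP: irreg => [corner|coll].
    have [b b_gt0 validE] := cornered_segmentations pi_perm size_ge3 corner.
    exists [:: refined pi 0; refined pi b]; split=> //=; rewrite inE andbT.
    by apply/eqP=> /refined_injective; lia.
  have [Es [? _ ? ?]] := collapsed_segmentations pi_perm size_ge3 coll.
  by exists Es.
have N_allowed : allow_neg_shift (1 + asc pi + epsilon_bar pi) s.
  case: Es Es_gt0 validE {uniq_Es} => // E Es _ /(_ E); rewrite mem_head.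
  exact: valid_segmentation_allowed.
split=> //.
- split=> // [|k k_ge2]; last by apply: N_min; lia.
  have [//|small] := ltnP 1 (1 + asc pi + epsilon_bar pi).
  (* Over a single letter all words coincide. *)
  have N1 : 1 + asc pi + epsilon_bar pi = 1 by lia.
  rewrite N1 in N_allowed; have [w [distinct _]] := N_allowed.
  have i0 : 0 < n by lia.
  have i1 : 1 < n by lia.
  by case: (distinct (Ordinal i0) (Ordinal i1)) => // m; rewrite !ord1.
- move=> reg; rewrite regN //.
  by rewrite (count _ [:: minimal_sequence pi]) // => E; apply: regular_segmentations.
- move=> corner; rewrite irregN ?corner //.
  have [b b_gt0 validE'] := cornered_segmentations pi_perm size_ge3 corner.
  rewrite (count _ _ _ validE') //= inE andbT.
  by apply/eqP=> /refined_injective; lia.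
move=> coll; rewrite irregN ?coll ?orbT // -size_pi.
have [Es' [uniq_Es' <- _ validE']] := collapsed_segmentations pi_perm size_ge3 coll.
exact: count validE'.
Qed.
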